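(* Let $(\Gamma_n,\mathcal{O})$ be a random oriented cubic graph on $n$ vertices ($n$ even), and let $S^C(\Gamma_n,\mathcal{O})$ be the associated compact Riemann surface. Then the expected genus $\boldsymbol{E}(\mathrm{genus}(S^C(\Gamma_n,\mathcal{O})))$ is of order $n$: there exist constants $0<c_1\le c_2$ such that for all sufficiently large even $n$, $$c_1 n\le \boldsymbol{E}\bigl(\mathrm{genus}(S^C(\Gamma_n,\mathcal{O}))\bigr)\le c_2 n .$$
   Context: Random cubic graph (Bollobas configuration model, $d=3$): let $W=\bigcup_{j=1}^n W_j$ be a disjoint union of $n$ sets with $|W_j|=3$, where $n$ is even, and let $2m=3n$. A configuration $F$ is a partition of $W$ into $m$ pairs, called edges. All configurations are equally likely. The graph $\Gamma_n=\phi(F)$ has vertex set $\{1,\dots,n\}$, and each pair of $F$ with one element in $W_i$ and the other in $W_j$ gives an edge joining $i$ and $j$ (loops and multiple edges are allowed). The elements of $W_j$ are the half-edges (edge-ends) at vertex $j$. Orientation: an orientation $\mathcal{O}$ on a cubic graph $\Gamma$ assigns to each vertex $v$ a cyclic ordering of the three edges (half-edges) emanating from $v$. The random orientation chooses, independently of the graph and independently at each vertex, one of the two cyclic orderings with probability $1/2$ each. Expectation is over both the random configuration and the random orientation. The surface $S^O(\Gamma,\mathcal{O})$: let $T$ be the ideal hyperbolic triangle in the upper half-plane with vertices $0,1,\infty$. Its sides have marked ''midpoints'' $i$, $i+1$, $\frac{i+1}{2}$, and the geodesics joining these to $\frac{1+i\sqrt3}{2}$ are regarded as three edges emanating from a vertex,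 with cyclic ordering $(i,\,i+1,\,\frac{i+1}{2})$. Take one copy of $T$ for each vertex $v$ of $\Gamma$, with its three sides matched to the three half-edges at $v$ compatibly with the cyclic ordering given by $\mathcal{O}$. For each edge of $\Gamma$, glue the two corresponding sides by the unique isometry that identifies their midpoints and respects the orientations of the copies of $T$. The result, $S^O(\Gamma,\mathcal{O})$, is a complete hyperbolic Riemann surface of finite area $\pi n$ with cusps. $S^C(\Gamma,\mathcal{O})$ is the conformal compactification of $S^O(\Gamma,\mathcal{O})$, i.e. the compact Riemann surface obtained by filling in each cusp (puncture) with a point. If $\Gamma$ is disconnected, the genus means the sum of the genera of the components. *)

(* Defs.v *)
From HB Require Import structures.
From Stdlib Require Import Relation_Operators.
From mathcomp Require Import all_boot all_order all_algebra all_fingroup.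
From mathcomp Require Import all_classical all_reals all_analysis.
From mathcomp Require Import complex.

Set Implicit Arguments.
Unset Strict Implicit.
Unset Printing Implicit Defensive.

Import Order.TTheory GRing.Theory Num.Theory.
Import numFieldNormedType.Exports.

Local Open Scope classical_set_scope.
Local Open Scope complex_scope.
Local Open Scope ring_scope.

Section SingularCohomology.
Variable R : realType.

Definition std_simplex (n : nat) : set 'rV[R]_n.+1 :=
  [set x | (forall i, 0 <= x ord0 i) /\ \sum_i x ord0 i = 1].
Arguments std_simplex : clear implicits.

Definition face_row (n : nat) (i : 'I_n.+2) (x : 'rV[R]_n.+1) : 'rV[R]_n.+2 :=
  \row_j (if unlift i j is Some k then x ord0 k else 0).

Lemma face_row_simplex n (i : 'I_n.+2) (x : std_simplex n) :
  face_row i (set_val x) \in std_simplex n.+1.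
Proof.
have [x0 x1] := set_valP x; apply/mem_set; split=> [j|].
  by rewrite mxE; case: unliftP.
rewrite (bigD1_ord i) //= mxE unlift_none add0r -[RHS]x1.
by apply: eq_bigr => j _; rewrite mxE liftK.
Qed.

Definition face_map (n : nat) (i : 'I_n.+2) (x : std_simplex n) :
  std_simplex n.+1 := SigSub (face_row_simplex i x).

Lemma face_row_continuous n (i : 'I_n.+2) : continuous (face_row i).
Proof.
move=> x; have FF : Filter (nbhs x) by exact: nbhs_filter.
apply/(@cvg_ballP _ _ _ _ FF) => e e0.
apply: (@filterS _ _ FF _ _ _ (nbhsx_ballx x e e0)) => t [_ xt].
split=> // j k; rewrite !mxE.
by case: unliftP => [l _|_]; [exact: xt | exact: ballxx].
Qed.

Lemma face_map_continuous n (i : 'I_n.+2) :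
  continuous (face_map i : std_simplex n -> std_simplex n.+1).
Proof.
apply: continuous_comp_initial => x.
apply: (@continuous_comp _ _ _ set_val (face_row i)).
  exact: initial_continuous.
exact: face_row_continuous.
Qed.

HB.instance Definition _ n (i : 'I_n.+2) :=
  isContinuous.Build (std_simplex n) (std_simplex n.+1) (face_map i)
    (@face_map_continuous n i).

Variable X : topologicalType.

Definition singular_simplex (n : nat) : Type :=
  continuousType (std_simplex n) X.

Definition cochain (n : nat) : Type := singular_simplex n -> R.

Definition coboundary (n : nat) (c : cochain n) : cochain n.+1 :=
  fun s => \sum_(i < n.+2) (-1) ^+ i * c (s \o face_map i).

Definition cocycles (n : nat) : set (cochain n) :=
  [set c | forall s, coboundary c s = 0].

Definition coboundaries (n : nat) : set (cochain n.+1) :=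
  [set c | exists b : cochain n, forall s, c s = coboundary b s].

(* The real vector space H^1(X; R) has dimension d: some d cocycles represent
   a basis of it. *)
Definition H1_dim (d : nat) : Prop :=
  exists z : 'I_d -> cochain 1,
    (forall i, cocycles (z i)) /\
    forall c, cocycles c ->
      exists! a : 'rV[R]_d,
        coboundaries (fun s => c s - \sum_i a ord0 i * z i s).

(* The default value 0 is used only when H^1(X; R) is infinite-dimensional,
   which does not happen for a compact surface. *)
Definition betti1 : nat := xget 0%N [set d | H1_dim d].

End SingularCohomology.

Section Genus.
Variable R : realType.

(* A compact connected orientable surface of genus g has b_1 = 2 g. *)
Definition genus (X : topologicalType) : R := (betti1 R X)%:R / 2.

Definition components (X : topologicalType) : set (set X) :=
  [set connected_component [set: X] x | x in [set: X]].
Arguments components : clear implicits.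

Definition total_genus (X : topologicalType) : R :=
  \sum_(C \in components X) genus (set_type C).

End Genus.

Section OrientedCubicGraphs.
Variable n : nat.

(* The half-edges at the vertex v are the three pairs (v, _). *)
Definition half_edge : finType := ('I_n * 'I_3)%type.

Definition configurations : {set {set {set half_edge}}} :=
  [set F : {set {set half_edge}} |
     finset.partition F [set: half_edge] & [forall e in F, #|e| == 2%N]]%SET.

(* A cyclic ordering of three objects is given by its successor permutation,
   which is one of the two 3-cycles. *)
Definition cyclic_ordering : finType := {s : {perm 'I_3} | #[s]%g == 3%N}.

Definition orientation : finType := {ffun 'I_n -> cyclic_ordering}.

(* The half-edges at v, enumerated in the cyclic ordering chosen there. *)
Definition ordered_half_edge (O : orientation) (v : 'I_n) (k : 'I_3) :
    half_edge :=
  (v, (val (O v) ^+ k)%g ord0).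

End OrientedCubicGraphs.

Section Surface.
Variable R : realType.

Definition riemann_sphere : Type := one_point_compactification R[i]^o.
HB.instance Definition _ := Topological.on riemann_sphere.

Definition ideal_triangle : set riemann_sphere :=
  [set Some z | z in [set z : R[i]^o |
     [/\ 0 <= complex.Re z <= 1, 0 < complex.Im z & 2^-1 <= `|z - 2^-1|]]].

Definition ideal_vertices : set riemann_sphere :=
  [set p | p = Some 0 \/ p = Some 1 \/ p = None].

(* z |-> (z - 1) / z, the rotation of the ideal triangle that permutes the
   midpoints of its sides as i -> i + 1 -> (i + 1) / 2 -> i. *)
Definition rotation (p : riemann_sphere) : riemann_sphere :=
  if p is Some z then if z == 0 then None else Some ((z - 1) / z) else Some 1.

(* z |-> - 1 / z, the half-turn about i. *)
Definition half_turn (p : riemann_sphere) : riemann_sphere :=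
  if p is Some z then if z == 0 then None else Some (- z^-1) else Some 0.

(* The side from 0 to oo, whose midpoint is i, together with its endpoints.
   The k-th side is the image of this one under the k-th iterate of
   [rotation]. *)
Definition side0 : set riemann_sphere :=
  [set p | p = None \/ exists2 t : R, 0 <= t & p = Some (0 +i* t)].

Section Gluing.
Variables (n : nat) (F : {set {set half_edge n}}) (O : orientation n).
Variable P : set riemann_sphere.

Definition copies : Type := {_ : 'I_n & P}.
HB.instance Definition _ := Topological.on copies.

(* [iter l rotation \o half_turn \o (iter k rotation)^-1] is the unique
   orientation-preserving isometry that maps the k-th side of the triangle to
   its l-th side, midpoint to midpoint, and the triangle itself to the opposite
   side of the image. *)
Definition glued (x y : copies) : Prop :=
  exists k l : 'I_3, exists2 p, side0 p &
    [/\ [set ordered_half_edge O (projT1 x) k;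
             ordered_half_edge O (projT1 y) l]%SET \in F,
        set_val (projT2 x) = iter k rotation p &
        set_val (projT2 y) = iter l rotation (half_turn p)].

Definition gluing (x y : copies) : bool :=
  `[< clos_refl_sym_trans _ glued x y >].

Lemma gluing_equiv : equiv_class_of gluing.
Proof.
split=> [x|x y|y x z]; first exact/asboolP/rst_refl.
  by apply/asboolP/asboolP; exact: rst_sym.
by move=> /asboolP xy /asboolP yz; exact/asboolP/(rst_trans _ _ _ y).
Qed.

Canonical gluing_rel := EquivRelPack gluing_equiv.

Definition glued_surface : Type :=
  quotient_topology {eq_quot gluing_rel}%qT.
HB.instance Definition _ := Topological.on glued_surface.

End Gluing.

Definition open_surface n (F : {set {set half_edge n}}) (O : orientation n) :
    topologicalType :=
  glued_surface F O ideal_triangle.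

(* Gluing the triangles together with their ideal vertices adds to the open
   surface one point for each of its cusps. *)
Definition compact_surface n (F : {set {set half_edge n}})
    (O : orientation n) : topologicalType :=
  glued_surface F O (ideal_triangle `|` ideal_vertices).

(* The configuration is uniform; given it, each of the two cyclic orderings is
   chosen with probability 1/2 independently at each of the n vertices. *)
Definition expected_genus (n : nat) : R :=
  \sum_(F in configurations n) \sum_(O : orientation n)
    #|configurations n|%:R^-1 * 2^-1 ^+ n * total_genus R (compact_surface F O).

End Surface.

(* Main.v *)
Require Import Defs.
From HB Require Import structures.
From Stdlib Require Import Relation_Operators.
From mathcomp Require Import all_boot all_order all_algebra all_fingroup cyclic.
From mathcomp Require Import all_classical all_reals all_analysis.
From mathcomp Require Import finmap complex.
From mathcomp Require Import zify lra ring.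

Set Implicit Arguments.
Unset Strict Implicit.
Unset Printing Implicit Defensive.

Import Order.TTheory GRing.Theory Num.Theory.
Import numFieldNormedType.Exports.

Local Open Scope classical_set_scope.
Local Open Scope complex_scope.
Local Open Scope ring_scope.

(* In the Klein model the ideal triangle is a straight triangle, the rotation
   permutes its barycentric coordinates and the half-turn swaps two of them on a
   side, so the compact surface is n simplices glued linearly along their sides.

   The open stars of the barycentric subdivision are contractible.  A cocycle has
   a primitive on each of them, and is a coboundary as soon as these primitives
   agree at one point of each of the at most 64 n overlaps; so the first Betti
   numbers of the components add up to at most 64 n.

   Conversely, a function that is affine on each triangle and whose increments
   along the glued sides match is a system of local potentials, which integrates
   to a singular cocycle.  Corner values with matching increments form a space of
   dimension at least 3n - 3n/2, and those giving coboundaries lie in a space of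
   dimension at most n + V, where V is the number of cusps; so the Betti numbers
   add up to at least n/2 - V.

   The cusps are the orbits of a permutation of the 3n half-edges.  Those of
   length at least 7 number at most 3n/7, and switching the partner of a half-edge
   shows that the expected number of half-edges in shorter cusps is bounded; hence
   the expectation of n/2 - V is at least n/14 - O(1). *)

(** * Affine geometry of the standard simplex *)

(** [betti1] is defined by singular cochains on an arbitrary space, with a default value when no
    finite basis exists, so finiteness has to be proved together with the bounds. The finitely many
    overlap jumps, taken on the whole surface, serve both purposes for all components at once: a
    cochain of a component is extended by zero.

    Working in degree one keeps everything elementary: subdivision becomes bisection of segments,
    and the comparison with simplicial cohomology reduces to cocycles integrated from local
    potentials. Open stars replace triangles because closed triangles do not cover by
    neighbourhoods; the price is that a contraction must be jointly continuous on a quotient space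
    times an interval, which is Whitehead's theorem.

    The orientation stays fixed in both estimates, and only the configuration is averaged over. The
    threshold 7 is the least length L with 3n/L < n/2. Below it a cusp forces the walk around it to
    return to a vertex within six steps, an event that involves boundedly many half-edges and has
    probability O(1/n) for each starting half-edge. *)

Notation simplex R n := (set_type (@std_simplex R n)).

Section Simplex.
Context {R : realType}.
Notation "'Δ' n" := (simplex R n) (at level 8).

Lemma continuous_mul (T : topologicalType) (f g : T -> R) :
  continuous f -> continuous g -> continuous (fun x => f x * g x).
Proof. by move=> fc gc x; apply: cvgM; [exact: fc|exact: gc]. Qed.

Lemma continuous_add (T : topologicalType) (f g : T -> R) :
  continuous f -> continuous g -> continuous (fun x => f x + g x).
Proof. by move=> fc gc x; apply: cvgD; [exact: fc|exact: gc]. Qed.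

Lemma continuous_div (T : topologicalType) (f g : T -> R) (x : T) :
  continuous f -> continuous g -> g x != 0 -> f y / g y @[y --> x] --> f x / g x.
Proof. by move=> fc gc g0; apply: cvgM; [exact: fc|apply: cvgV => //; exact: gc]. Qed.

Lemma continuous_sum (T : topologicalType) (I : finType) (f : I -> T -> R) :
  (forall i, continuous (f i)) -> continuous (fun x => \sum_i f i x).
Proof.
move=> fc; apply: continuous_big; first exact: add_continuous.
by move=> i _; exact: fc.
Qed.

Definition bcoord n (x : Δ n) (i : 'I_n.+1) : R := set_val x ord0 i.

Lemma bcoord_ge0 n (x : Δ n) i : 0 <= bcoord x i.
Proof. by have [h _] := set_valP x; exact: h. Qed.

Lemma sum_bcoord n (x : Δ n) : \sum_i bcoord x i = 1.
Proof. by have [_] := set_valP x. Qed.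

Lemma bcoord_inj n (x y : Δ n) : bcoord x =1 bcoord y -> x = y.
Proof.
by move=> xy; apply/val_inj/matrixP => i j; rewrite (ord1 i); exact: xy.
Qed.

Lemma mk_simplex_proof n (f : 'I_n.+1 -> R) :
  (forall i, 0 <= f i) -> \sum_i f i = 1 -> (\row_i f i) \in @std_simplex R n.
Proof.
move=> f0 f1; apply/mem_set; split=> [i|]; first by rewrite mxE.
by rewrite -[RHS]f1; apply: eq_bigr => i _; rewrite mxE.
Qed.

Definition mk_simplex n (f : 'I_n.+1 -> R) (f0 : forall i, 0 <= f i)
  (f1 : \sum_i f i = 1) : Δ n := SigSub (mk_simplex_proof f0 f1).

Lemma bcoord_mk n (f : 'I_n.+1 -> R) f0 f1 : bcoord (@mk_simplex n f f0 f1) =1 f.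
Proof. by move=> i; rewrite /bcoord /set_val /= mxE. Qed.

Lemma bcoord_continuous_simplex n (i : 'I_n.+1) :
  continuous (fun x : Δ n => bcoord x i).
Proof.
move=> x; apply: (@continuous_comp _ _ _ set_val (fun y : 'rV[R]_n.+1 => y ord0 i)).
  exact: initial_continuous.
exact: coord_continuous.
Qed.

Definition sclose n (e : R) (x y : Δ n) := forall i, `|bcoord x i - bcoord y i| < e.

Lemma nbhs_sclose n (x : Δ n) (A : set (Δ n)) :
  nbhs x A <-> exists2 e : R, 0 < e & sclose e x `<=` A.
Proof.
split=> [|[e e0 eA]].
  move=> [B [[W oW <-] Wx]] sBA.
  have /nbhs_ballP[e e0 eW] : nbhs (set_val x) W by apply: open_nbhs_nbhs.
  exists e => // y xy; apply/sBA/eW; split=> // i j; rewrite (ord1 i).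
  exact: xy.
apply: (filterS eA).
apply: (@filter_forall _ _ (fun i => [set y | `|bcoord x i - bcoord y i| < e]) (nbhs x)) => i.
have := @bcoord_continuous_simplex n i x.
by move=> /(_ _ (nbhsx_ballx _ _ e0)); apply.
Qed.

Lemma simplex_continuous (T : topologicalType) n (f : T -> Δ n) :
  (forall i, continuous (fun t => bcoord (f t) i)) -> continuous f.
Proof.
move=> fc x A /nbhs_sclose[e e0 eA].
apply: (filterS (P := fun y => sclose e (f x) (f y))).
  by move=> y Py; exact: eA.
apply: filter_forall => i.
by have := @fc i x _ (nbhsx_ballx _ _ e0); apply.
Qed.

Lemma compact_set_type (T : topologicalType) (A : set T) :
  compact A -> compact [set: A].
Proof.
move=> /compact_near_coveringP/near_covering_withinP cA.
apply/compact_near_coveringP => I F P FF FP.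
have /(_ F (fun i x => forall a : A, set_val a = x -> P i a) FF) := cA I.
have H (x : T) : A x -> \forall x' \near x & i \near F, A x' ->
    forall a : A, set_val a = x' -> P i a.
  move=> Ax; have [[U V] /= [Ux FV] UV] := FP (exist _ x (mem_set Ax)) Logic.I.
  have [B [[W oW WB] Wx] BU] := Ux.
  exists (W, V) => /=.
    split=> //; apply: open_nbhs_nbhs; split=> //.
    by move: Wx; rewrite -WB.
  move=> [y i] /= [Wy Vi] Ay a ay; apply: (UV (a, i)); split => //=.
  by apply: BU; rewrite -WB /= ay.
move=> /(_ H); apply: filterS => i + a _; apply => //; exact: set_valP.
Qed.

Lemma compact_simplex n : compact [set: Δ n].
Proof.
apply: compact_set_type; apply: bounded_closed_compact.
  exists 1; split=> // M M1 x [x0 x1] /=.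
  apply: le_trans (ltW M1); rewrite /Num.Def.normr/= mx_normrE.
  apply: (bigmax_le _ ler01) => -[i j] _ /=; rewrite (ord1 i) ger0_norm //.
  by rewrite -x1 (bigD1 j) //= lerDl sumr_ge0.
have cl : closed
    ((\bigcap_(i in [set: 'I_n.+1])
       ((fun x : 'rV[R]_n.+1 => x ord0 i) @^-1` [set y | 0 <= y]))
    `&` ((fun x : 'rV[R]_n.+1 => \sum_i x ord0 i) @^-1` [set 1])).
  apply: closedI.
    apply: closed_bigI => i _; apply: closed_comp; last exact: closed_ge.
    by move=> x _; exact: coord_continuous.
  apply: closed_comp; last exact: closed_eq.
  move=> x _; apply: continuous_big; first exact: add_continuous.
  by move=> i _; exact: coord_continuous.
move: cl; congr closed.
by apply/seteqP; split=> x /= [x0 x1]; split => // i; [exact: (x0 i Logic.I)|move=> _; exact: x0].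
Qed.

(** Compactness is used in its near-covering form with the filter e -> 0+: if the e-ball at x lies
    in a member of the cover, the e/2-balls at the points within e/2 of x do too, so one radius
    serves all points. *)
Lemma lebesgue_number n (I : Type) (V : I -> set (Δ n)) :
  (forall x : Δ n, exists i, nbhs x (V i)) ->
  exists2 e : R, 0 < e & forall x, exists i, sclose e x `<=` V i.
Proof.
move=> Vcov.
have /compact_near_coveringP/(_ R (0^'+) (fun e x => exists i, sclose e x `<=` V i)) :=
  @compact_simplex n.
case.
  move=> x _; have [i /nbhs_sclose[e e0 eV]] := Vcov x.
  have e2 : 0 < e / 2 by rewrite divr_gt0.
  exists (sclose (e / 2) x, [set d | d < e / 2]) => /=.
    split; first by apply/nbhs_sclose; exists (e / 2).
    exact: nbhs_right_lt.
  move=> [y d] /= [xy de]; exists i => z yz; apply: eV => k.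
  have := xy k; have := yz k => h1 h2.
  rewrite [e]splitr (_ : _ - _ = (bcoord x k - bcoord y k) + (bcoord y k - bcoord z k)); last by ring.
  apply: le_lt_trans (ler_normD _ _) _; apply: ltrD => //.
  exact: lt_trans h1 de.
move=> e /= e0 H; exists (e / 2); first by rewrite divr_gt0.
move=> x; apply: H => //=.
- by rewrite sub0r normrN gtr0_norm ?divr_gt0 // ltr_pdivrMr // ltr_pMr // ltr1n.
- by rewrite divr_gt0.
Qed.

Definition aff_fun n m (p : 'I_m.+1 -> Δ n) (x : Δ m) (i : 'I_n.+1) : R :=
  \sum_k bcoord x k * bcoord (p k) i.

Lemma aff_ge0 n m (p : 'I_m.+1 -> Δ n) x i : 0 <= aff_fun p x i.
Proof. by apply: sumr_ge0 => k _; rewrite mulr_ge0 ?bcoord_ge0. Qed.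

Lemma aff_sum n m (p : 'I_m.+1 -> Δ n) x : \sum_i aff_fun p x i = 1.
Proof.
rewrite exchange_big /= -[RHS](sum_bcoord x); apply: eq_bigr => k _.
by rewrite -mulr_sumr sum_bcoord mulr1.
Qed.

Definition aff n m (p : 'I_m.+1 -> Δ n) (x : Δ m) : Δ n :=
  mk_simplex (aff_ge0 p x) (aff_sum p x).

Lemma bcoord_aff n m (p : 'I_m.+1 -> Δ n) x i :
  bcoord (aff p x) i = \sum_k bcoord x k * bcoord (p k) i.
Proof. exact: bcoord_mk. Qed.

Lemma aff_continuous n m (p : 'I_m.+1 -> Δ n) : continuous (aff p).
Proof.
apply: simplex_continuous => i.
under eq_fun do rewrite bcoord_aff.
apply: continuous_sum => k; apply: continuous_mul; first exact: bcoord_continuous_simplex.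
by move=> ?; exact: cst_continuous.
Qed.

Lemma aff_comp n m l (p : 'I_m.+1 -> Δ n) (q : 'I_l.+1 -> Δ m) :
  aff p \o aff q = aff (aff p \o q).
Proof.
apply/funext => x; apply: bcoord_inj => i /=; rewrite !bcoord_aff.
under eq_bigr do rewrite bcoord_aff mulr_suml.
rewrite exchange_big; apply: eq_bigr => k _ /=.
by rewrite bcoord_aff mulr_sumr; apply: eq_bigr => j _; rewrite mulrA.
Qed.

Lemma vert_ge0 n (j i : 'I_n.+1) : 0 <= (i == j)%:R :> R.
Proof. exact: ler0n. Qed.

Lemma vert_sum n (j : 'I_n.+1) : \sum_i (i == j)%:R = 1 :> R.
Proof.
rewrite (bigD1 j) //= eqxx big1 ?addr0 // => i /negbTE ->.
by [].
Qed.

Definition vert n (j : 'I_n.+1) : Δ n := mk_simplex (vert_ge0 j) (vert_sum j).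

Lemma bcoord_vert n (j i : 'I_n.+1) : bcoord (vert j) i = (i == j)%:R.
Proof. exact: bcoord_mk. Qed.

Lemma aff_vert n m (p : 'I_m.+1 -> Δ n) j : aff p (vert j) = p j.
Proof.
apply: bcoord_inj => i; rewrite bcoord_aff (bigD1 j) //= bcoord_vert eqxx mul1r.
rewrite big1 ?addr0 // => k /negbTE kj; by rewrite bcoord_vert kj mul0r.
Qed.

Lemma aff_id n : aff (@vert n) = id.
Proof.
apply/funext => x; apply: bcoord_inj => i; rewrite bcoord_aff (bigD1 i) //=.
rewrite bcoord_vert eqxx mulr1 big1 ?addr0 // => k /negbTE ki.
by rewrite bcoord_vert eq_sym ki mulr0.
Qed.

Lemma aff_cst n m (a : Δ n) : @aff n m (fun=> a) = fun=> a.
Proof.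
apply/funext => x; apply: bcoord_inj => i; rewrite bcoord_aff -mulr_suml.
by rewrite sum_bcoord mul1r.
Qed.

Definition seg n (a b : Δ n) : Δ 1 -> Δ n :=
  aff (fun i : 'I_2 => if i == ord0 then a else b).

Definition tri n (a b c : Δ n) : Δ 2 -> Δ n :=
  aff (fun i : 'I_3 => if i == ord0 then a else if i == 1 :> nat then b else c).

Lemma face_mapE n (i : 'I_n.+2) :
  face_map i = aff (fun k => vert (lift i k)) :> (Δ n -> Δ n.+1).
Proof.
apply/funext => x; apply: bcoord_inj => j; rewrite bcoord_aff.
rewrite /bcoord /set_val /= mxE.
case: unliftP => [k ->|->].
  rewrite (bigD1 k) //= /bcoord /set_val /= mxE eqxx mulr1 big1 ?addr0 // => l lk.
  by rewrite mxE (inj_eq lift_inj) eq_sym (negbTE lk) mulr0.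
by rewrite big1 // => k _; rewrite mxE (negbTE (neq_lift _ _)) mulr0.
Qed.

Lemma face_map_continuous n (i : 'I_n.+2) : continuous (@face_map R n i).
Proof. rewrite face_mapE; exact: aff_continuous. Qed.

Lemma tri_face0 n (a b c : Δ n) : tri a b c \o face_map ord0 = seg b c.
Proof.
rewrite face_mapE /tri aff_comp /seg; congr aff; apply/funext => k /=.
by rewrite aff_vert; case: k => -[|[|]].
Qed.

Lemma tri_face1 n (a b c : Δ n) : tri a b c \o face_map 1 = seg a c.
Proof.
rewrite face_mapE /tri aff_comp /seg; congr aff; apply/funext => k /=.
by rewrite aff_vert; case: k => -[|[|]].
Qed.

Lemma tri_face2 n (a b c : Δ n) : tri a b c \o face_map ord_max = seg a b.
Proof.
rewrite face_mapE /tri aff_comp /seg; congr aff; apply/funext => k /=.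
by rewrite aff_vert; case: k => -[|[|]].
Qed.

Lemma seg_vert n (p : 'I_2 -> Δ n) : aff p = seg (p ord0) (p ord_max).
Proof.
by congr aff; apply/funext => k; case: ifPn => [/eqP -> //|k0]; congr p;
  apply/val_inj; move: k0; case: k => -[|[|]].
Qed.

Lemma seg0 n (a b : Δ n) : seg a b (vert ord0) = a.
Proof. by rewrite /seg aff_vert. Qed.

Lemma seg1 n (a b : Δ n) : seg a b (vert ord_max) = b.
Proof. by rewrite /seg aff_vert. Qed.

Lemma seg_continuous n (a b : Δ n) : continuous (seg a b).
Proof. exact: aff_continuous. Qed.

Lemma tri_continuous n (a b c : Δ n) : continuous (tri a b c).
Proof. exact: aff_continuous. Qed.

Lemma seg_id : seg (vert ord0) (vert ord_max) = id :> (Δ 1 -> Δ 1).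
Proof. by rewrite -[RHS]aff_id [RHS]seg_vert. Qed.

Lemma bcoord_seg n (a b : Δ n) x i :
  bcoord (seg a b x) i = bcoord x ord0 * bcoord a i + bcoord x ord_max * bcoord b i.
Proof. by rewrite bcoord_aff !big_ord_recl big_ord0 /= addr0; congr (_ + bcoord x _ * _); apply/val_inj. Qed.

Lemma bcoord1E (x : Δ 1) : bcoord x ord0 = 1 - bcoord x ord_max.
Proof.
rewrite -(sum_bcoord x) !big_ord_recl big_ord0 addr0.
by rewrite (_ : lift _ _ = ord_max) ?addrK //; apply/val_inj.
Qed.

Lemma half_ge0 : 0 <= 2^-1 :> R. Proof. by rewrite invr_ge0. Qed.

Definition half_pt : Δ 1.
Proof.
refine (@mk_simplex 1 (fun=> 2^-1) (fun=> half_ge0) _).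
by rewrite !big_ord_recl big_ord0 addr0; lra.
Defined.

Definition mid n (a b : Δ n) : Δ n := seg a b half_pt.

Lemma bcoord_mid n (a b : Δ n) i : bcoord (mid a b) i = (bcoord a i + bcoord b i) / 2.
Proof. by rewrite bcoord_seg !bcoord_mk; lra. Qed.

Lemma midC n (a b : Δ n) : mid a b = mid b a.
Proof. by apply: bcoord_inj => i; rewrite !bcoord_mid addrC. Qed.

Lemma sclose_sym n e (a b : Δ n) : sclose e a b -> sclose e b a.
Proof. by move=> ab i; rewrite distrC. Qed.

Lemma sclose_mid_l n e (a b : Δ n) : sclose (2 * e) a b -> sclose e a (mid a b).
Proof.
move=> ab i; have := ab i; rewrite bcoord_mid !ltr_norml => /andP[h1 h2].
by apply/andP; split; lra.
Qed.

Lemma sclose_mid_r n e (a b : Δ n) : sclose (2 * e) a b -> sclose e (mid a b) b.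
Proof. by rewrite midC => /sclose_sym/sclose_mid_l/sclose_sym. Qed.

Lemma sclose_mid_mid n e (a b c : Δ n) :
  sclose (2 * e) a b -> sclose e (mid c a) (mid c b).
Proof.
move=> ab i; have := ab i; rewrite !bcoord_mid !ltr_norml => /andP[h1 h2].
by apply/andP; split; lra.
Qed.

Lemma sclose_le n e e' (a b : Δ n) : e <= e' -> sclose e a b -> sclose e' a b.
Proof. by move=> ee ab i; apply: lt_le_trans ee; exact: ab. Qed.

Lemma sclose_refl n e (a : Δ n) : 0 < e -> sclose e a a.
Proof. by move=> e0 i; rewrite subrr normr0. Qed.

Lemma sclose_seg n e (a b c : Δ n) x : sclose e c a -> sclose e c b -> sclose e c (seg a b x).
Proof.
move=> ca cb i; have := ca i; have := cb i; rewrite bcoord_seg bcoord1E.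
have := bcoord_ge0 x ord_max; have := bcoord_ge0 x ord0; rewrite bcoord1E.
rewrite !ltr_norml => t1 t2 /andP[h1 h2] /andP[h3 h4].
set t := bcoord x ord_max in t1 t2 *.
have conv (u v : R) : 0 < u -> 0 < v -> 0 < (1 - t) * u + t * v.
  by move=> u0 v0; case: (lerP t (1 / 2)) => ht; nra.
have := conv _ _ (ltac:(lra) : 0 < e - (bcoord c i - bcoord a i))
  (ltac:(lra) : 0 < e - (bcoord c i - bcoord b i)).
have := conv _ _ (ltac:(lra) : 0 < e + (bcoord c i - bcoord a i))
  (ltac:(lra) : 0 < e + (bcoord c i - bcoord b i)).
by move=> k1 k2; apply/andP; split; nra.
Qed.

Lemma bcoord_le1 n (x : Δ n) i : bcoord x i <= 1.
Proof. by rewrite -(sum_bcoord x) (bigD1 i) //= lerDl sumr_ge0 // => *; exact: bcoord_ge0. Qed.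

Lemma sclose2 n (a b : Δ n) : sclose 2 a b.
Proof.
move=> i; have := bcoord_le1 a i; have := bcoord_le1 b i.
by have := bcoord_ge0 a i; have := bcoord_ge0 b i; rewrite ltr_norml => *; apply/andP; split; lra.
Qed.

Lemma exp2_big (e : R) : 0 < e -> exists k : nat, 2 <= 2 ^+ k * e.
Proof.
move=> e0; have [k] : exists k : nat, 2 / e <= k%:R.
  exists (Num.bound (2 / e)); apply/ltW/archi_boundP.
  by rewrite divr_ge0 // ltW.
rewrite ler_pdivrMr // => h; exists k; apply: (le_trans h).
rewrite ler_pM2r // -natrX ler_nat; apply: ltnW; exact: ltn_expl.
Qed.

(** Induction on segments by bisection. Two points are always 2-close and each bisection halves the
    distance, so k bisections with [2 <= 2 ^+ k * e] reach the base case. *)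
Lemma halving_ind n (Q : Δ n -> Δ n -> Prop) (e : R) : 0 < e ->
  (forall a b, sclose e a b -> Q a b) ->
  (forall a b, Q a (mid a b) -> Q (mid a b) b -> Q a b) ->
  forall a b, Q a b.
Proof.
move=> e0 Qe Qmid a b; have [k ke] := exp2_big e0.
have : sclose (2 ^+ k * e) a b by apply: sclose_le ke _; exact: sclose2.
elim: k a b {ke} => [|k IH] a b; first by rewrite mul1r; exact: Qe.
rewrite exprS -mulrA => ab; apply: Qmid; apply: IH; [exact: sclose_mid_l|exact: sclose_mid_r].
Qed.

(** The target is a bare type: with [Prop] as target this gives the connectedness of the simplex,
    and with real values it compares local primitives. *)
Lemma locally_constant n (T : Type) (f : Δ n -> T) :
  (forall x, \forall y \near x, f y = f x) -> forall x y, f x = f y.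
Proof.
move=> fl.
have [e e0 eP] := @lebesgue_number n (Δ n) (fun x => [set y | f y = f x]) (fun x => ex_intro _ x (fl x)).
apply: (halving_ind e0) => [a b ab|a b -> //].
have [i iP] := eP a; rewrite (iP _ ab) (iP a) //.
exact: sclose_refl.
Qed.

Lemma connected_simplex n : connected [set: Δ n].
Proof.
move=> B [b Bb] [C oC BC] [D cD BD].
have BE : B = C by rewrite BC setTI.
have BF : B = D by rewrite BD setTI.
apply/seteqP; split=> // x _.
rewrite (@locally_constant n Prop (fun y => B y) _ x b) // => y.
have [By|nBy] := pselect (B y).
  have : nbhs y B by apply: open_nbhs_nbhs; split=> //; rewrite BE.
  by apply: filterS => z Bz; apply/propext.
have : nbhs y (~` B) by apply: open_nbhs_nbhs; split=> //; rewrite BF; exact: closed_openC.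
by apply: filterS => z Bz; apply/propext.
Qed.

End Simplex.

(** * Singular 1-cocycles and local potentials *)

Lemma pair_continuous (T A B : topologicalType) (f : T -> A) (g : T -> B) :
  continuous f -> continuous g -> continuous (fun x => (f x, g x)).
Proof. by move=> fc gc x; apply: cvg_pair; [exact: fc|exact: gc]. Qed.

Lemma uncurry_comp_continuous (T S X Y : topologicalType) (f : T -> X) (H : X -> S -> Y) :
  continuous f ->
  (forall t s, {for (f t, s), continuous (fun z : X * S => H z.1 z.2)}) ->
  continuous (fun z : T * S => H (f z.1) z.2).
Proof.
move=> fc Hc [t s].
apply: (@continuous_comp _ _ _ (fun z : T * S => (f z.1, z.2)) (fun z : X * S => H z.1 z.2)).
  apply: pair_continuous => z; last exact: cvg_snd.
  by apply: continuous_comp; [exact: cvg_fst|exact: fc].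
exact: Hc.
Qed.

Section Cochains.
Context {R : realType} {X : topologicalType}.
Notation "'Δ' n" := (simplex R n) (at level 8).

(* The junk value 0 on discontinuous functions keeps continuity proofs out of
   the expressions. *)
Definition ceval n (c : cochain R X n) (f : Δ n -> X) : R :=
  match pselect (continuous f) with
  | left h => c (mkcts h)
  | right _ => 0
  end.

Lemma ceval_simplex n (c : cochain R X n) (s : singular_simplex R X n) :
  ceval c s = c s.
Proof.
rewrite /ceval; case: pselect => [h|nh].
  by congr c; apply/continuousEP.
by exfalso; apply: nh; exact: cts_fun.
Qed.

Lemma coboundaryE n (c : cochain R X n) (s : singular_simplex R X n.+1) :
  coboundary c s = \sum_(i < n.+2) (-1) ^+ i * ceval c (s \o face_map i).
Proof.
apply: eq_bigr => i _; congr (_ * _).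
by rewrite -(ceval_simplex c).
Qed.

Lemma coboundary1 (c : cochain R X 1) (s : singular_simplex R X 2) :
  coboundary c s = ceval c (s \o face_map ord0) - ceval c (s \o face_map 1)
    + ceval c (s \o face_map ord_max).
Proof.
rewrite coboundaryE !big_ord_recl big_ord0 /= expr0 expr1 !expr2 addr0 addrA.
rewrite !mulN1r opprK !mul1r.
by congr (_ - ceval c (_ \o face_map _) + ceval c (_ \o face_map _)); apply/val_inj.
Qed.

Lemma coboundary0 (b : X -> R) (s : singular_simplex R X 1) :
  coboundary (fun u : singular_simplex R X 0 => b (u (vert ord0))) s =
    b (s (vert ord_max)) - b (s (vert ord0)).
Proof.
rewrite /coboundary !big_ord_recl big_ord0 /= expr0 expr1 addr0 mul1r mulN1r.
by rewrite !face_mapE !aff_vert; congr (b (s (vert _)) - b (s (vert _))); apply/val_inj.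
Qed.

Lemma cocycle_faces (c : cochain R X 1) (f : Δ 2 -> X) :
  cocycles c -> continuous f ->
  ceval c (f \o face_map 1) =
    ceval c (f \o face_map ord_max) + ceval c (f \o face_map ord0).
Proof.
move=> cc fc; have := cc (mkcts fc); rewrite coboundary1 /= /mkcts => h.
lra.
Qed.

(** The triangle [tri a b d] may be degenerate; when b lies on the segment from a to d, this is
    additivity under subdivision. *)
Lemma cocycle_split n (c : cochain R X 1) (f : Δ n -> X) a b d :
  cocycles c -> continuous f ->
  ceval c (f \o seg a d) = ceval c (f \o seg a b) + ceval c (f \o seg b d).
Proof.
move=> cc fc; have fct : continuous (f \o tri a b d).
  by move=> x; apply: continuous_comp; [exact: tri_continuous|exact: fc].
have := cocycle_faces cc fct.
have E k : (f \o tri a b d) \o face_map k = f \o (tri a b d \o face_map k) by [].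
by rewrite !E tri_face0 tri_face1 tri_face2.
Qed.

Lemma cocycle_cst (c : cochain R X 1) (x : X) : cocycles c -> ceval c (fun=> x) = 0.
Proof.
move=> cc; have := @cocycle_faces c (fun=> x) cc (fun y => @cst_continuous _ _ x y).
set k := ceval c _ => h; have : k = k + k by exact: h.
lra.
Qed.

Lemma ceval_sum n (I : finType) (a : I -> R) (z : I -> cochain R X n) f :
  ceval (fun s => \sum_i a i * z i s) f = \sum_i a i * ceval (z i) f.
Proof. by rewrite /ceval; case: pselect => // _; rewrite big1 // => i _; rewrite mulr0. Qed.

Lemma cocycle_sum n (I : finType) (a : I -> R) (z : I -> cochain R X n) :
  (forall i, cocycles (z i)) -> cocycles (fun s => \sum_i a i * z i s).
Proof.
move=> zc s; rewrite coboundaryE.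
under eq_bigr do rewrite ceval_sum mulr_sumr.
rewrite exchange_big big1 // => i _ /=.
under eq_bigr do rewrite mulrCA.
by rewrite -mulr_sumr -coboundaryE zc mulr0.
Qed.

Lemma cocycleB n (c d : cochain R X n) :
  cocycles c -> cocycles d -> cocycles (fun s => c s - d s).
Proof.
move=> cc dc s; rewrite /coboundary.
under eq_bigr do rewrite mulrBr.
by rewrite sumrB -!/(coboundary _ s) cc dc subrr.
Qed.

Lemma coboundary_cocycle (b : X -> R) :
  cocycles (fun s : singular_simplex R X 1 => b (s (vert ord_max)) - b (s (vert ord0))).
Proof.
move=> s; rewrite /coboundary !big_ord_recl big_ord0 /=.
rewrite !face_mapE !aff_vert expr0 expr1 expr2 addr0 /=.
have -> : lift (lift ord0 ord0) (ord_max : 'I_2) = lift ord0 ord_max :> 'I_3 by apply/val_inj.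
have -> : lift (lift ord0 (lift ord0 ord0)) (ord0 : 'I_2) = lift (lift ord0 ord0) ord0 :> 'I_3 by apply/val_inj.
have -> : lift (lift ord0 (lift ord0 ord0)) (ord_max : 'I_2) = lift ord0 ord0 :> 'I_3 by apply/val_inj.
lra.
Qed.

Fixpoint dyadic_sum n (D : Δ n -> Δ n -> R) (k : nat) (a b : Δ n) : R :=
  if k is k'.+1 then dyadic_sum D k' a (mid a b) + dyadic_sum D k' (mid a b) b
  else D a b.

Section Cover.
Variables (I : Type) (U : I -> set X).
Hypothesis Ucov : forall x : X, exists i, nbhs x (U i).

(** The theorem of small simplices in degree one: a path is bisected until each piece lies in a
    member of the cover, and a cocycle is additive under bisection. *)
Lemma cocycle_small (c : cochain R X 1) : cocycles c ->
  (forall i (f : Δ 1 -> X), continuous f -> (forall t, U i (f t)) -> ceval c f = 0) ->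
  forall s, c s = 0.
Proof.
move=> cc c0 s.
have sc : continuous s by exact: cts_fun.
have [e e0 eP] := @lebesgue_number _ _ _ (fun i => s @^-1` U i)
  (fun x => let: ex_intro i h := Ucov (s x) in ex_intro _ i (sc _ _ h)).
rewrite -ceval_simplex -[Continuous.sort s]/(s \o id) -seg_id.
move: (vert ord0) (vert ord_max); apply: (halving_ind e0) => [a b ab|a b am mb].
  have [i iP] := eP a; apply: (c0 i).
    by move=> x; apply: continuous_comp; [exact: seg_continuous|exact: sc].
  move=> t; apply: iP; apply: sclose_seg => //; exact: sclose_refl.
by rewrite (cocycle_split _ (mid a b)) // am mb addr0.
Qed.

Lemma coboundary_small (c : cochain R X 1) (b : X -> R) : cocycles c ->
  (forall i (f : Δ 1 -> X), continuous f -> (forall t, U i (f t)) ->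
     ceval c f = b (f (vert ord_max)) - b (f (vert ord0))) ->
  coboundaries c.
Proof.
move=> cc cb; exists (fun u : singular_simplex R X 0 => b (u (vert ord0))) => s.
rewrite coboundary0; apply/eqP; rewrite -subr_eq0; apply/eqP.
pose c' (s : singular_simplex R X 1) := c s - (b (s (vert ord_max)) - b (s (vert ord0))).
apply: (@cocycle_small c'); first exact: (cocycleB cc (coboundary_cocycle b)).
move=> i f fc fU; rewrite -[f]/(mkcts fc : _ -> _) (ceval_simplex c' (mkcts fc)) /c'.
by rewrite -ceval_simplex (cb i) // subrr.
Qed.

Variable b : I -> X -> R.
Hypothesis b_loc : forall i j x, U i x -> U j x ->
  \forall y \near x, U i y -> U j y -> b i y - b j y = b i x - b j x.

(** The family [b] acts as the local primitives of a closed 1-form whose differences are locally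
    constant on overlaps; P is then a primitive of its pullback along f. *)
Definition primitive n (f : Δ n -> X) (P : Δ n -> R) :=
  forall a : Δ n, exists i, \forall y \near a,
    U i (f y) /\ P y - P a = b i (f y) - b i (f a).

Lemma primitive_unique n (f : Δ n -> X) P Q : continuous f ->
  primitive f P -> primitive f Q -> forall x y, P x - P y = Q x - Q y.
Proof.
move=> fc fP fQ x y.
suff : P x - Q x = P y - Q y by lra.
apply: (@locally_constant _ _ _ (fun x => P x - Q x)) => a.
have [i iP] := fP a; have [j jQ] := fQ a.
have [Uia _] := nbhs_singleton iP; have [Uja _] := nbhs_singleton jQ.
have ij := fc a _ (b_loc Uia Uja).
apply: filterS3 iP jQ ij => z [h1 h2] [h3 h4] /(_ h1 h3) h5.
lra.
Qed.

Lemma primitive_comp n m (f : Δ n -> X) P (g : Δ m -> Δ n) : continuous g ->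
  primitive f P -> primitive (f \o g) (P \o g).
Proof. by move=> gc fP a; have [i iP] := fP (g a); exists i; exact: gc iP. Qed.

(* Path integration: the increments of the local potentials are summed over fine
   dyadic subdivisions of segments, and cutting triangles in four reduces the
   triangle relation to small triangles. *)
Lemma primitive_exists n (f : Δ n -> X) : continuous f -> exists P, primitive f P.
Proof.
move=> fc.
have [e e0 eP] := @lebesgue_number _ _ _ (fun i => f @^-1` U i)
  (fun x => let: ex_intro i h := Ucov (f x) in ex_intro _ i (fc _ _ h)).
have [i iP] := choice eP.
pose D a y := b (i a) (f y) - b (i a) (f a).
(* [D a] and [D x] use the potentials chosen at a and at x. The segment from x to y lies in both
   members of the cover, so the difference of the two potentials has the same value at its ends. *)
have Dadd a x y : sclose e a x -> sclose e a y -> sclose e x y -> D a x + D x y = D a y.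
  move=> ax ay xy.
  pose g t := b (i a) (f (seg x y t)) - b (i x) (f (seg x y t)).
  have : g (vert ord_max) = g (vert ord0).
    apply: locally_constant => t.
    have Ua z : U (i a) (f (seg x y z)) by apply: (iP a); exact: sclose_seg.
    have Ux z : U (i x) (f (seg x y z)).
      by apply: (iP x); apply: sclose_seg => //; exact: sclose_refl.
    have fsc : continuous (f \o seg x y).
      by move=> z; apply: continuous_comp; [exact: seg_continuous|exact: fc].
    have h : \forall z \near t, U (i a) (f (seg x y z)) -> U (i x) (f (seg x y z)) -> g z = g t.
      exact: fsc (b_loc (Ua t) (Ux t)).
    by apply: filterS h => z; exact.
  rewrite /g seg0 seg1 /D; lra.
have Jtri k a x y : sclose (2 ^+ k * e) a x -> sclose (2 ^+ k * e) a y ->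
    sclose (2 ^+ k * e) x y -> dyadic_sum D k a x + dyadic_sum D k x y = dyadic_sum D k a y.
  elim: k a x y => [|k IH] a x y; first by rewrite mul1r; exact: Dadd.
  rewrite exprS -mulrA => ax ay xy /=.
  have ra := sclose_mid_l ax; have rb := sclose_mid_r ax.
  have rc := sclose_mid_l ay; have rd := sclose_mid_r ay.
  have re := sclose_mid_l xy; have rf := sclose_mid_r xy.
  have m1 : sclose (2 ^+ k * e) (mid a x) (mid a y) by exact: sclose_mid_mid.
  have m2 : sclose (2 ^+ k * e) (mid a x) (mid x y).
    by rewrite (midC a x); exact: sclose_mid_mid.
  have m3 : sclose (2 ^+ k * e) (mid a y) (mid x y).
    by rewrite (midC a y) (midC x y); exact: sclose_mid_mid.
  have := IH _ _ _ ra rc m1.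
  have := IH _ _ _ rb m2 re.
  have := IH _ _ _ m3 rd rf.
  have := IH _ _ _ m1 m2 m3.
  lra.
(* On close points, further bisection does not change the sum; near a the global sum is therefore
   the local potential up to a constant. *)
have JD k a y : sclose e a y -> dyadic_sum D k a y = D a y.
  elim: k a y => // k IH a y ay /=.
  have ay2 : sclose (2 * e) a y by apply: sclose_le ay; lra.
  have h1 := sclose_mid_l ay2; have h2 := sclose_mid_r ay2.
  by rewrite !IH // Dadd.
have [k ke] := exp2_big e0.
have cl (x y : Δ n) : sclose (2 ^+ k * e) x y by apply: sclose_le ke _; exact: sclose2.
exists (dyadic_sum D k (vert ord0)) => a; exists (i a).
apply/nbhs_sclose; exists e => // y ay; split; first exact: (iP a).
rewrite -(Jtri k (vert ord0) a y) // addrC addKr.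
exact: JD.
Qed.

(** The cochain sends a path to the increment of a primitive along it. It is a cocycle because one
    primitive on a 2-simplex restricts to primitives on all three faces, and increments do not
    depend on the primitive. *)
Lemma potential_cocycle : exists2 c : cochain R X 1, cocycles c &
  forall (f : Δ 1 -> X) P, continuous f -> primitive f P ->
    ceval c f = P (vert ord_max) - P (vert ord0).
Proof.
have /choice[Q QP] : forall s : singular_simplex R X 1, exists P, primitive s P.
  by move=> s; apply: primitive_exists; exact: cts_fun.
pose c (s : singular_simplex R X 1) := Q s (vert ord_max) - Q s (vert ord0).
have cP (f : Δ 1 -> X) P : continuous f -> primitive f P ->
    ceval c f = P (vert ord_max) - P (vert ord0).
  move=> fc fP; rewrite -[f]/(mkcts fc : _ -> _) (ceval_simplex c (mkcts fc)) /c.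
  exact: (primitive_unique fc (QP (mkcts fc)) fP).
exists c => // s; rewrite coboundary1.
have sc : continuous s by exact: cts_fun.
have [P sP] := primitive_exists sc.
have fE (k : 'I_3) : ceval c (s \o face_map k) =
    P (face_map k (vert ord_max)) - P (face_map k (vert ord0)).
  rewrite (cP _ (P \o face_map k)) //.
    by move=> x; apply: continuous_comp; [exact: face_map_continuous|exact: sc].
  by apply: primitive_comp => //; exact: face_map_continuous.
rewrite !fE !face_mapE !aff_vert.
have -> : lift 1 (ord_max : 'I_2) = lift ord0 ord_max :> 'I_3 by apply/val_inj.
have -> : lift 1 (ord0 : 'I_2) = lift ord_max ord0 :> 'I_3 by apply/val_inj.
have -> : lift ord_max (ord_max : 'I_2) = lift ord0 ord0 :> 'I_3 by apply/val_inj.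
lra.
Qed.

End Cover.

(** * Cocycles on contractible open sets *)

Section Contraction.
Variables (U : set X) (p : X) (H : X -> Δ 1 -> X).
Hypothesis Hc : forall x t, U x -> {for (x, t), continuous (fun z : X * Δ 1 => H z.1 z.2)}.
Hypothesis H0 : forall x, U x -> H x (vert ord0) = p.
Hypothesis H1 : forall x, U x -> H x (vert ord_max) = x.

(* The square (u, t) |-> H (f u) t is cut into two triangles; its bottom side is
   constant. *)
Lemma contraction_cocycle (c : cochain R X 1) (f : Δ 1 -> X) :
  cocycles c -> continuous f -> (forall t, U (f t)) ->
  ceval c f = ceval c (H (f (vert ord_max))) - ceval c (H (f (vert ord0))).
Proof.
move=> cc fc fU.
pose G (z : Δ 1 * Δ 1) := H (f z.1) z.2.
have Gc : continuous G.
  by apply: (@uncurry_comp_continuous _ _ _ _ f H fc) => t s; exact: Hc.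
pose g a a' b b' := ceval c (fun x => G (seg a b x, seg a' b' x)).
have gtri a a' b b' d d' : g a a' d d' = g a a' b b' + g b b' d d'.
  have Fc : continuous (fun x : Δ 2 => G (tri a b d x, tri a' b' d' x)).
    move=> x; apply: (@continuous_comp _ _ _ (fun x => (tri a b d x, tri a' b' d' x)) G); last exact: Gc.
    by apply: pair_continuous; exact: tri_continuous.
  have := cocycle_faces cc Fc; rewrite /g.
  rewrite -(tri_face0 a b d) -(tri_face0 a' b' d') -(tri_face1 a b d) -(tri_face1 a' b' d').
  by rewrite -(tri_face2 a b d) -(tri_face2 a' b' d').
have cst_seg (a : Δ 1) : seg a a = fun=> a.
  rewrite /seg -(aff_cst 1 a); congr aff.
  by apply/funext => k; rewrite if_same.
have E1 : ceval c f = g (vert ord0) (vert ord_max) (vert ord_max) (vert ord_max).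
  congr ceval; apply/funext => x; rewrite /G /= cst_seg seg_id /=.
  by rewrite H1.
have E2 u : ceval c (H (f u)) = g u (vert ord0) u (vert ord_max).
  by congr ceval; apply/funext => x; rewrite /G /= cst_seg seg_id.
have E3 : g (vert ord0) (vert ord0) (vert ord_max) (vert ord0) = 0.
  rewrite -(cocycle_cst p cc); congr ceval; apply/funext => x.
  by rewrite /G /= cst_seg H0.
have := gtri (vert ord0) (vert ord0) (vert ord_max) (vert ord0) (vert ord_max) (vert ord_max).
have := gtri (vert ord0) (vert ord0) (vert ord0) (vert ord_max) (vert ord_max) (vert ord_max).
rewrite E1 !E2 E3; lra.
Qed.

End Contraction.

End Cochains.

(** * Joint continuity on a quotient space times a locally compact space *)

Section QuotientTimesCompact.
Context {W : Type} {A X T Y : topologicalType}.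
Variable psi : W -> A -> X.
Hypothesis psi_c : forall w, continuous (psi w).
Hypothesis psi_open : forall V : set X, (forall w, open (psi w @^-1` V)) -> open V.
Hypothesis psi_surj : forall x, exists w a, psi w a = x.
Hypothesis T_lc : forall (t : T) B, nbhs t B -> exists N, [/\ compact N, nbhs t N & N `<=` B].

(* Whitehead: a quotient map times a locally compact space is a quotient map. *)
Lemma quotient_joint_continuity (U : set X) (f : X -> T -> Y) : open U ->
  (forall w a t, U (psi w a) ->
     {for (a, t), continuous (fun z : A * T => f (psi w z.1) z.2)}) ->
  forall x t, U x -> {for (x, t), continuous (fun z : X * T => f z.1 z.2)}.
Proof.
move=> oU fc x t Ux B; rewrite nbhsE => -[B' [oB' B'x] B'B].
have [w [a xE]] := psi_surj x.
have [[P Q] /= [Pa Qt] PQ] : nbhs (a, t) (fun z : A * T => B' (f (psi w z.1) z.2)).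
  have := fc w a t; rewrite xE => /(_ Ux B'); apply.
  by rewrite /= xE; exact: open_nbhs_nbhs.
have [N [cN tN NQ]] := T_lc Qt.
(* The points whose whole slice over the compact N is sent into B'. Openness of V is tested on the
   charts, where it is the tube lemma. *)
pose V := [set x' | U x' /\ forall t', N t' -> B' (f x' t')].
have oV : open V.
  apply: psi_open => w'; rewrite openE => a' [/= Ua' Na'].
  have Un : \forall a'' \near a', U (psi w' a'').
    by apply: psi_c; exact: open_nbhs_nbhs.
  have Nn : \forall a'' \near a', N `<=` (fun t' => B' (f (psi w' a'') t')).
    apply: ((compact_near_coveringP N).1 cN A (nbhs a')
      (fun a'' t' => B' (f (psi w' a'') t'))) => t' Nt'.
    have /= := fc w' a' t' Ua' B' (open_nbhs_nbhs (conj oB' (Na' t' Nt'))).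
    case=> [[P' Q'] /= [P'a Q't] PQ']; exists (Q', P') => //= -[t'' a''] /= [h1 h2].
    exact: (PQ' (a'', t'')).
  by apply: filterS2 Un Nn => a'' h1 h2; split => // t'; exact: h2.
have Vx : V x.
  split=> // t' Nt'; rewrite -xE; apply: (PQ (a, t')); split => /=.
    exact: nbhs_singleton.
  exact: NQ.
exists (V, N); first by split => //; exact: open_nbhs_nbhs.
by move=> [x' t'] /= [[_ Vx'] Nt']; apply: B'B; exact: Vx'.
Qed.

End QuotientTimesCompact.

Lemma simplex_locally_compact (R : realType) n (t : simplex R n) (B : set (simplex R n)) :
  nbhs t B -> exists N, [/\ compact N, nbhs t N & N `<=` B].
Proof.
move=> /nbhs_sclose[e e0 eB].
pose N := [set t' : simplex R n | forall k, `|bcoord (t : simplex R n) k - bcoord t' k| <= e / 2].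
exists N; split.
- apply: (subclosed_compact _ (@compact_simplex R n)) => //.
  have -> : N = \bigcap_(k in [set: 'I_n.+1])
      ((fun t' : simplex R n => bcoord t' k) @^-1` (closed_ball (bcoord (t : simplex R n) k) (e / 2))).
    apply/seteqP; split=> y /= h k; last first.
      by have := h k Logic.I; rewrite /= closed_ballE ?divr_gt0.
    by move=> _; rewrite /= closed_ballE ?divr_gt0 //; exact: h.
  apply: closed_bigI => k _; apply: closed_comp; last exact: closed_ball_closed.
  by move=> y _; exact: bcoord_continuous_simplex.
- by apply/nbhs_sclose; exists (e / 2); [rewrite divr_gt0|move=> y ty k; exact: ltW].
- move=> y Ny; apply: eB => k; apply: le_lt_trans (Ny k) _.
  by rewrite ltr_pdivrMr // ltr_pMr // ltr1n.
Qed.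

(** * Betti numbers and connected components *)

Lemma linear_dependence (F : fieldType) (I J : finType) (M : I -> J -> F) :
  (#|J| < #|I|)%N ->
  exists2 a : I -> F, exists i, a i != 0 & forall j, \sum_i a i * M i j = 0.
Proof.
move=> JI; pose A : 'M[F]_(#|I|, #|J|) := \matrix_(i, j) M (enum_val i) (enum_val j).
have : kermx A != 0.
  rewrite -mxrank_eq0 mxrank_ker subn_eq0 -ltnNge.
  exact: leq_ltn_trans (rank_leq_col A) JI.
case/rowV0Pn => v /sub_kermxP vA v0.
have /rV0Pn[i vi] := v0.
exists (fun i => v ord0 (enum_rank i)); first by exists (enum_val i); rewrite enum_valK.
move=> j; have := congr1 (fun B : 'rV_ _ => B ord0 (enum_rank j)) vA.
rewrite !mxE => vAj; rewrite -[RHS]vAj (reindex (@enum_val I I)) /=; last first.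
  exact/onW_bij/enum_val_bij.
by apply: eq_bigr => k _; rewrite enum_valK mxE enum_rankK.
Qed.

Section LinearAlgebra.
Context {R : realType} {X : topologicalType}.
Implicit Types c : cochain R X 1.

Definition independent (I : finType) (z : I -> cochain R X 1) :=
  (forall i, cocycles (z i)) /\
  forall a : I -> R, coboundaries (fun s => \sum_i a i * z i s) -> forall i, a i = 0.

Lemma coboundary_sum n (I : finType) (a : I -> R) (b : I -> cochain R X n) s :
  coboundary (fun u => \sum_i a i * b i u) s = \sum_i a i * coboundary (b i) s.
Proof.
rewrite /coboundary; under eq_bigr do rewrite mulr_sumr.
rewrite exchange_big; apply: eq_bigr => i _ /=; rewrite mulr_sumr.
by apply: eq_bigr => j _; rewrite mulrCA.
Qed.

Lemma coboundaries_ext n (c d : cochain R X n.+1) : c =1 d -> coboundaries c -> coboundaries d.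
Proof. by move=> cd [b cb]; exists b => s; rewrite -cd. Qed.

Lemma coboundaries_sum n (I : finType) (a : I -> R) (c : I -> cochain R X n.+1) :
  (forall i, coboundaries (c i)) -> coboundaries (fun s => \sum_i a i * c i s).
Proof.
move=> /choice[b bP]; exists (fun u => \sum_i a i * b i u) => s.
by rewrite coboundary_sum; apply: eq_bigr => i _; rewrite bP.
Qed.

Lemma coboundaries_lin n (c d : cochain R X n.+1) (k l : R) :
  coboundaries c -> coboundaries d -> coboundaries (fun s => k * c s + l * d s).
Proof.
move=> cc dc.
apply: (coboundaries_ext _ (@coboundaries_sum n bool (fun x => if x then k else l)
   (fun x => if x then c else d) _)); last by case.
by move=> s; rewrite big_bool.
Qed.

Lemma coboundaries0 n : coboundaries ((fun=> 0) : cochain R X n.+1).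
Proof.
exists (fun=> 0) => s; rewrite /coboundary big1 // => i _; by rewrite mulr0.
Qed.

Definition linear_functional (ev : cochain R X 1 -> R) :=
  forall (I : finType) (a : I -> R) (z : I -> cochain R X 1),
    ev (fun s => \sum_i a i * z i s) = \sum_i a i * ev (z i).

(** Functionals that detect coboundaries among cocycles embed H^1 into the space of functions on
    K. *)
Lemma independent_card (K I : finType) (ev : K -> cochain R X 1 -> R) z :
  (forall k, linear_functional (ev k)) ->
  (forall c, cocycles c -> (forall k, ev k c = 0) -> coboundaries c) ->
  independent (z : I -> cochain R X 1) -> (#|I| <= #|K|)%N.
Proof.
move=> evl ev0 [zc zi]; rewrite leqNgt; apply/negP => KI.
have [a [i ai] a0] := linear_dependence (fun i k => ev k (z i)) KI.
move/eqP: ai; apply; apply: zi; apply: ev0; first exact: cocycle_sum.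
by move=> k; rewrite evl a0.
Qed.

Lemma H1_dimP d : H1_dim R X d <-> exists z : 'I_d -> cochain R X 1,
  independent z /\ forall c, cocycles c ->
    exists a : 'I_d -> R, coboundaries (fun s => c s - \sum_i a i * z i s).
Proof.
split=> [[z [zc zb]]|[z [[zc zi] zs]]]; exists z.
  split; last first.
    by move=> c /zb[a [ca _]]; exists (a ord0).
  split=> // a az i.
  have c0 : cocycles ((fun=> 0) : cochain R X 1).
    by move=> s; rewrite /coboundary big1 // => j _; rewrite mulr0.
  have [a0 [_ a0u]] := zb _ c0.
  have /(congr1 (fun v : 'rV_ _ => v ord0 i)) : a0 = 0.
    apply: a0u; apply: coboundaries_ext (coboundaries0 0) => s.
    by rewrite big1 ?subrr // => j _; rewrite mxE mul0r.
  have /(congr1 (fun v : 'rV_ _ => v ord0 i)) : a0 = \row_i - a i.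
    apply: a0u; apply: (coboundaries_ext _ (coboundaries_lin 1 0 az az)) => s.
    rewrite mul1r mul0r addr0 sub0r -sumrN; apply: eq_bigr => j _.
    by rewrite mxE mulNr opprK.
  by rewrite !mxE => -> /eqP; rewrite oppr_eq0 => /eqP.
split=> // c /zs[a ca]; exists (\row_i a i); split.
  by apply: coboundaries_ext ca => s; congr (_ - _); apply: eq_bigr => i _; rewrite mxE.
move=> a' ca'; apply/rowP => i; rewrite mxE; apply/eqP; rewrite -subr_eq0.
apply/eqP; apply: (zi (fun i => a i - a' ord0 i)).
apply: (coboundaries_ext _ (coboundaries_lin 1 (-1) ca' ca)) => s.
rewrite mul1r mulN1r opprB addrC addrA subrK.
by rewrite -sumrB; apply: eq_bigr => j _; rewrite mulrBl.
Qed.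

Lemma independent_le_dim (I : finType) (w : I -> cochain R X 1) d :
  H1_dim R X d -> independent w -> (#|I| <= d)%N.
Proof.
move=> /H1_dimP[z [_ zs]] [wc wi].
have /choice[M MP] : forall i, exists a : 'I_d -> R,
    coboundaries (fun s => w i s - \sum_j a j * z j s) by move=> i; exact: zs.
rewrite -[leqRHS]card_ord leqNgt; apply/negP => dI.
have [a [i ai] a0] := linear_dependence M dI.
move/eqP: ai; apply; apply: wi.
apply: (coboundaries_ext _ (coboundaries_sum a MP)) => s.
under eq_bigr do rewrite mulrBr.
rewrite sumrB; under [X in _ - X]eq_bigr do rewrite mulr_sumr.
rewrite exchange_big [X in _ - X]big1 ?subr0 // => j _ /=.
by under eq_bigr do rewrite mulrA; rewrite -mulr_suml a0 mul0r.
Qed.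

Lemma betti1E d : H1_dim R X d -> betti1 R X = d.
Proof.
move=> Xd; apply: xget_unique => // d' Xd'; apply/eqP; rewrite eqn_leq.
have /H1_dimP[z [zi _]] := Xd; have /H1_dimP[z' [zi' _]] := Xd'.
have := independent_le_dim Xd zi'; have := independent_le_dim Xd' zi.
by rewrite !card_ord => -> ->.
Qed.

(** Rules out the default value of [betti1]. Independent families have at most [#|K|] members, and
    one of maximal size spans: adding any cocycle c creates a dependence in which c has a nonzero
    coefficient. *)
Lemma H1_dim_exists (K : finType) (ev : K -> cochain R X 1 -> R) :
  (forall k, linear_functional (ev k)) ->
  (forall c, cocycles c -> (forall k, ev k c = 0) -> coboundaries c) ->
  H1_dim R X (betti1 R X).
Proof.
move=> evl ev0.
pose P d := `[< exists z : 'I_d -> cochain R X 1, independent z >].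
have P0 : exists d, P d.
  exists 0; apply/asboolP; exists (fun=> fun=> 0); split=> [[]|a _ []] //.
have PK d : P d -> (d <= #|K|)%N.
  by move=> /asboolP[z zi]; rewrite -[leqLHS]card_ord; exact: independent_card ev0 zi.
case: (ex_maxnP P0 PK) => d /asboolP[z [zc zi]] dmax.
suff Xd : H1_dim R X d by rewrite (betti1E Xd).
apply/H1_dimP; exists z; split=> // c cc.
pose z' (i : 'I_d.+1) := if unlift ord0 i is Some j then z j else c.
have z'c i : cocycles (z' i) by rewrite /z'; case: unlift.
have /existsNP[a /not_implyP[az /existsNP[i ai]]] :
    ~ forall a : 'I_d.+1 -> R, coboundaries (fun s => \sum_i a i * z' i s) -> forall i, a i = 0.
  move=> z'i; have /dmax : P d.+1 by apply/asboolP; exists z'.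
  by rewrite ltnn.
have E s : \sum_i a i * z' i s = a ord0 * c s + \sum_j a (lift ord0 j) * z j s.
  by rewrite big_ord_recl /z' unlift_none; congr (_ + _); apply: eq_bigr => j _; rewrite liftK.
have a0 : a ord0 != 0.
  apply/eqP => a0; apply: ai; have [j ->|-> //] := unliftP ord0 i.
  apply: (zi (fun j => a (lift ord0 j))).
  by apply: coboundaries_ext az => s; rewrite E a0 mul0r add0r.
exists (fun j => - ((a ord0)^-1 * a (lift ord0 j))).
apply: (coboundaries_ext _ (coboundaries_lin (a ord0)^-1 0 az az)) => s.
rewrite mul0r addr0 E mulrDr mulKf //; congr (_ + _).
by rewrite mulr_sumr -sumrN; apply: eq_bigr => j _; rewrite mulNr opprK mulrA.
Qed.

End LinearAlgebra.

(** * Splitting cochains over the components *)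

Section Components.
Context {R : realType} {X : topologicalType} {T : finType}.
Variable C : T -> set X.
Hypothesis Ccov : forall x, exists t, C t x.
Hypothesis Cdisj : forall t t' x, C t x -> C t' x -> t = t'.
Hypothesis Cconn : forall n (f : simplex R n -> X) t a b,
  continuous f -> C t (f a) -> C t (f b).

Definition restrict_cochain t n (c : cochain R X n) : cochain R (C t) n :=
  fun s => ceval c (set_val \o s).
Arguments restrict_cochain t [n] c _.

Definition corestrict t n (f : simplex R n -> X) (h : forall y, C t (f y)) :
  simplex R n -> C t := fun y => SigSub (mem_set (h y)).

(** Extension by zero. As every simplex lies in one piece, this commutes with the coboundary, and
    the cochains of X are the product of the cochains of the pieces. *)
Definition extend_cochain t n (c : cochain R (C t) n) : cochain R X n := fun s =>
  match pselect (forall y, C t (s y)) with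
  | left h => ceval c (corestrict h)
  | right _ => 0
  end.

Lemma corestrict_continuous t n (f : simplex R n -> X) (h : forall y, C t (f y)) :
  continuous f -> continuous (corestrict h).
Proof. by move=> fc; apply: continuous_comp_initial => x; exact: fc. Qed.

Lemma set_val_comp_continuous t n (s : simplex R n -> C t) :
  continuous s -> continuous (set_val \o s : simplex R n -> X).
Proof. by move=> sc x; apply: continuous_comp; [exact: sc|exact: initial_continuous]. Qed.

Lemma extend_in t n (c : cochain R (C t) n) (f : simplex R n -> X) (h : forall y, C t (f y)) :
  continuous f -> ceval (extend_cochain c) f = ceval c (corestrict h).
Proof.
move=> fc; rewrite -[f]/(mkcts fc : _ -> _) (ceval_simplex (extend_cochain c) (mkcts fc)).
rewrite /extend_cochain; case: pselect => // h'; congr ceval.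
by apply/funext => y; exact/val_inj.
Qed.

Lemma extend_out t n (c : cochain R (C t) n) (f : simplex R n -> X) y :
  ~ C t (f y) -> ceval (extend_cochain c) f = 0.
Proof.
move=> Cy; rewrite /ceval; case: pselect => // fc.
by rewrite /extend_cochain; case: pselect => // h; have := h y.
Qed.

Lemma coboundary_restrict t n (c : cochain R X n) s :
  coboundary (restrict_cochain t c) s = ceval (coboundary c) (set_val \o s).
Proof.
have sc : continuous (set_val \o s : simplex R n.+1 -> X).
  by apply: set_val_comp_continuous; exact: cts_fun.
rewrite -[set_val \o s]/(mkcts sc : _ -> _) (ceval_simplex (coboundary c) (mkcts sc)).
by rewrite [RHS]coboundaryE.
Qed.

Lemma coboundary_extend t n (c : cochain R (C t) n) s :
  coboundary (extend_cochain c) s = extend_cochain (coboundary c) s.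
Proof.
have sc : continuous s by exact: cts_fun.
rewrite coboundaryE /extend_cochain; case: pselect => [h|nh].
  have hc := @corestrict_continuous _ _ _ h sc.
  rewrite -[corestrict h]/(mkcts hc : _ -> _) (ceval_simplex (coboundary c) (mkcts hc)).
  rewrite coboundaryE; apply: eq_bigr => i _; congr (_ * _).
  have hi y : C t ((s \o face_map i) y) by exact: h.
  rewrite (extend_in _ hi); last first.
    by move=> x; apply: continuous_comp; [exact: face_map_continuous|exact: sc].
  by congr ceval; apply/funext => y; exact/val_inj.
have [y Cy] : exists y, ~ C t (s y) by exact/existsNP.
rewrite big1 // => i _; rewrite (@extend_out _ _ _ _ (vert ord0)) ?mulr0 //.
by move=> /= h; apply: Cy; exact: Cconn h.
Qed.

Lemma restrict_extend t n (c : cochain R (C t) n) s :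
  restrict_cochain t (extend_cochain c) s = c s.
Proof.
rewrite /restrict_cochain (@extend_in _ _ _ _ (fun y => set_valP (s y))); last first.
  by apply: set_val_comp_continuous; exact: cts_fun.
rewrite -ceval_simplex; congr ceval; apply/funext => y; exact/val_inj.
Qed.

Lemma restrict_extend_neq t t' n (c : cochain R (C t) n) s :
  t != t' -> restrict_cochain t' (extend_cochain c) s = 0.
Proof.
move=> /eqP tt'; apply: (@extend_out _ _ _ _ (vert ord0)) => /= h; apply: tt'.
exact: Cdisj h (set_valP _).
Qed.

Lemma sum_extend_restrict n (c : cochain R X n) s :
  c s = \sum_t extend_cochain (restrict_cochain t c) s.
Proof.
have sc : continuous s by exact: cts_fun.
have [t Ct] := Ccov (s (vert ord0)).
have h y : C t (s y) by exact: Cconn sc Ct.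
rewrite (bigD1 t) //= big1 ?addr0 => [|t' tt'].
  rewrite -[RHS]ceval_simplex (extend_in _ h) //.
  have hc := @corestrict_continuous _ _ _ h sc.
  rewrite -[corestrict h]/(mkcts hc : _ -> _) (ceval_simplex (restrict_cochain t c) (mkcts hc)).
  by rewrite /restrict_cochain -[LHS]ceval_simplex; congr ceval.
rewrite -ceval_simplex (@extend_out _ _ _ _ (vert ord0)) // => h'.
by move/eqP: tt'; apply; exact: Cdisj h' Ct.
Qed.

Lemma restrict_cocycle t n (c : cochain R X n) :
  cocycles c -> cocycles (restrict_cochain t c).
Proof.
move=> cc s; rewrite coboundary_restrict /ceval; case: pselect => // h; exact: cc.
Qed.

Lemma extend_cocycle t n (c : cochain R (C t) n) :
  cocycles c -> cocycles (extend_cochain c).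
Proof.
move=> cc s; rewrite coboundary_extend /extend_cochain; case: pselect => // h.
by rewrite /ceval; case: pselect => // h'; exact: cc.
Qed.

Lemma restrict_coboundaries t n (c : cochain R X n.+1) :
  coboundaries c -> coboundaries (restrict_cochain t c).
Proof.
move=> [b cb]; exists (restrict_cochain t b) => s.
by rewrite coboundary_restrict /restrict_cochain /ceval; case: pselect.
Qed.

Lemma coboundaries_restrict n (c : cochain R X n.+1) :
  (forall t, coboundaries (restrict_cochain t c)) -> coboundaries c.
Proof.
move=> rc; have bP t : exists b : cochain R (C t) n, forall s, restrict_cochain t c s = coboundary b s.
  exact: rc.
pose b t := sval (cid (bP t)).
have bE t s : restrict_cochain t c s = coboundary (b t) s by exact: (svalP (cid (bP t))).
exists (fun u => \sum_t 1 * extend_cochain (b t) u) => s.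
rewrite coboundary_sum sum_extend_restrict; apply: eq_bigr => t _.
rewrite mul1r coboundary_extend; congr extend_cochain.
by apply/funext => u; exact: bE.
Qed.

Lemma restrict_sum t n (I : finType) (a : I -> R) (z : I -> cochain R X n) s :
  restrict_cochain t (fun s => \sum_i a i * z i s) s =
    \sum_i a i * restrict_cochain t (z i) s.
Proof. exact: ceval_sum. Qed.

Lemma extend_sum t n (I : finType) (a : I -> R) (z : I -> cochain R (C t) n) s :
  extend_cochain (fun s => \sum_i a i * z i s) s = \sum_i a i * extend_cochain (z i) s.
Proof.
rewrite /extend_cochain; case: pselect => [h|_]; first exact: ceval_sum.
by rewrite big1 // => i _; rewrite mulr0.
Qed.

(** Each restricted cocycle has coordinates in a basis for its piece; with more cocycles than
    coordinates in all, some combination restricts to a coboundary on every piece. *)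
Lemma sum_betti1_ge (I : finType) (w : I -> cochain R X 1) :
  (forall t, H1_dim R (C t) (betti1 R (C t))) -> independent w ->
  (#|I| <= \sum_t betti1 R (C t))%N.
Proof.
move=> Cd [wc wi].
have /(_ _)/cid-/all_sig[z zP] : forall t, exists z : 'I_(betti1 R (C t)) -> cochain R (C t) 1,
    forall c, cocycles c -> exists a : 'I_(betti1 R (C t)) -> R,
      coboundaries (fun s => c s - \sum_i a i * z i s).
  by move=> t; have /H1_dimP[z [_ zs]] := Cd t; exists z.
have /(_ _ _)/cid-/(_ _)/all_sig-/all_sig[M MP] : forall i t, exists a : 'I_(betti1 R (C t)) -> R,
    coboundaries (fun s => restrict_cochain t (w i) s - \sum_j a j * z t j s).
  by move=> i t; apply: zP; exact: restrict_cocycle.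
have cardE : #|{: {t : T & 'I_(betti1 R (C t))}}| = (\sum_t betti1 R (C t))%N.
  by rewrite card_tagged sumnE big_map -big_enum /=; apply: eq_bigr => t _; rewrite card_ord.
rewrite -cardE leqNgt; apply/negP => dI.
have [a [i ai] a0] := linear_dependence (fun i (p : {t : T & 'I_(betti1 R (C t))}) => M (tag p) i (tagged p)) dI.
move/eqP: ai; apply; apply: wi; apply: coboundaries_restrict => t.
apply: (coboundaries_ext _ (coboundaries_sum a (MP t))) => s.
rewrite restrict_sum; under eq_bigr do rewrite mulrBr.
rewrite sumrB; under [X in _ - X]eq_bigr do rewrite mulr_sumr.
rewrite exchange_big [X in _ - X]big1 ?subr0 // => j _ /=.
under eq_bigr do rewrite mulrA; rewrite -mulr_suml.
by have := a0 (Tagged (fun t => 'I_(betti1 R (C t))) j) => /= ->; rewrite mul0r.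
Qed.

Section Upper.
Variables (K : finType) (ev : K -> cochain R X 1 -> R).
Hypothesis evl : forall k, linear_functional (ev k).
Hypothesis ev0 : forall c, cocycles c -> (forall k, ev k c = 0) -> coboundaries c.

Lemma component_H1_dim t : H1_dim R (C t) (betti1 R (C t)).
Proof.
apply: (@H1_dim_exists _ _ _ (fun k c => ev k (extend_cochain c))) => [k I a z|c cc c0].
  rewrite -evl; congr (ev k _); apply/funext => s; exact: extend_sum.
have := restrict_coboundaries t (ev0 (extend_cocycle cc) c0).
by apply: coboundaries_ext => s; exact: restrict_extend.
Qed.

(** Bases of all pieces, extended by zero, are jointly independent: restriction to a piece recovers
    its own basis and kills the others. *)
Lemma sum_betti1_le : (\sum_t betti1 R (C t) <= #|K|)%N.
Proof.
have /(_ _)/cid-/all_sig[z zP] : forall t, exists z : 'I_(betti1 R (C t)) -> cochain R (C t) 1, independent z.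
  by move=> t; have /H1_dimP[z [zi _]] := component_H1_dim t; exists z.
have cardE : #|{: {t : T & 'I_(betti1 R (C t))}}| = (\sum_t betti1 R (C t))%N.
  by rewrite card_tagged sumnE big_map -big_enum /=; apply: eq_bigr => t _; rewrite card_ord.
rewrite -cardE.
apply: (@independent_card _ _ _ _ ev (fun p => extend_cochain (z (tag p) (tagged p)))) => //.
split=> [p|a az [t j]]; first by apply: extend_cocycle; exact: (zP _).1.
apply: ((zP t).2 (fun j => a (Tagged (fun t => 'I_(betti1 R (C t))) j)) _ j).
apply: coboundaries_ext (restrict_coboundaries t az) => s.
rewrite restrict_sum; transitivity (\sum_(t' : T) \sum_(j : 'I_(betti1 R (C t')))
    a (Tagged (fun t => 'I_(betti1 R (C t))) j) *
      restrict_cochain t (extend_cochain (z t' j)) s).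
  by rewrite sig_big_dep /=; apply: eq_bigr => -[t' k].
rewrite (bigD1 t) //= [X in _ + X]big1 ?addr0.
  by apply: eq_bigr => k _; rewrite restrict_extend.
by move=> t' tt'; rewrite big1 // => k _; rewrite restrict_extend_neq // mulr0.
Qed.

End Upper.
End Components.

Section TotalGenus.
Context {R : realType} {X : topologicalType}.
Hypothesis fin : finite_set (@components X).

Lemma total_genusE : total_genus R X =
  (\sum_(C : fset_set (@components X)) betti1 R (val C : set X))%:R / 2.
Proof.
rewrite /total_genus fsbig_finite // big_seq_fsetE /= natr_sum mulr_suml.
by [].
Qed.

Lemma componentsP (C : fset_set (@components X)) : exists x, val C = connected_component [set: X] x.
Proof. have := valP C; rewrite /= in_fset_set // => /set_mem[x _ <-]; by exists x. Qed.

Lemma components_cover x : exists C : fset_set (@components X), val C x.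
Proof.
have h : connected_component [set: X] x \in fset_set (@components X).
  by rewrite in_fset_set //; apply/mem_set; exists x.
by exists [` h]%fset => /=; exact: connected_component_refl.
Qed.

Lemma components_disjoint (C C' : fset_set (@components X)) x : val C x -> val C' x -> C = C'.
Proof.
move=> Cx C'x; apply: val_inj; have [y yE] := componentsP C; have [z zE] := componentsP C'.
rewrite yE in Cx *; rewrite zE in C'x *.
by rewrite (same_connected_component Cx) (same_connected_component C'x).
Qed.

Lemma components_simplex n (f : simplex R n -> X) (C : fset_set (@components X)) a b :
  continuous f -> val C (f a) -> val C (f b).
Proof.
move=> fc; have [y ->] := componentsP C => ya.
rewrite (same_connected_component ya).
apply: (@connected_component_max _ _ (f @` [set: simplex R n])).
- by exists a.
- by [].
- by apply: connected_continuous_connected; [exact: connected_simplex|exact: continuous_subspaceT].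
- by exists b.
Qed.

End TotalGenus.

Lemma total_genus_le (R : realType) (X : topologicalType) (K : finType)
    (ev : K -> cochain R X 1 -> R) :
  finite_set (@components X) ->
  (forall k, linear_functional (ev k)) ->
  (forall c, cocycles c -> (forall k, ev k c = 0) -> coboundaries c) ->
  total_genus R X <= #|K|%:R / 2.
Proof.
move=> fin evl ev0; rewrite total_genusE // ler_pM2r ?invr_gt0 // ler_nat.
apply: (@sum_betti1_le _ _ _ (fun C : fset_set (@components X) => val C) _ _ _ ev) => //.
- exact: components_disjoint.
- by move=> n f t a b; exact: components_simplex.
Qed.

Lemma total_genus_ge (R : realType) (X : topologicalType) (K I : finType)
    (ev : K -> cochain R X 1 -> R) (w : I -> cochain R X 1) :
  finite_set (@components X) ->
  (forall k, linear_functional (ev k)) ->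
  (forall c, cocycles c -> (forall k, ev k c = 0) -> coboundaries c) ->
  independent w -> #|I|%:R / 2 <= total_genus R X.
Proof.
move=> fin evl ev0 wi; rewrite total_genusE // ler_pM2r ?invr_gt0 // ler_nat.
apply: (@sum_betti1_ge _ _ _ (fun C : fset_set (@components X) => val C)) wi => //.
- exact: components_cover.
- exact: components_disjoint.
- by move=> n f t a b; exact: components_simplex.
- move=> t; apply: (@component_H1_dim _ _ _ (fun C : fset_set (@components X) => val C) _ _ ev) => //.
  by move=> n f t' a b; exact: components_simplex.
Qed.

(** * Surfaces glued from triangles *)

(* The k-th side of a triangle joins the corners - k and 1 - k of 'I_3, and is
   opposite to the corner - 1 - k; [flip k l] matches the corners of the k-th
   side of a triangle with those of the l-th side of another one, reversing the
   direction. *)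
Definition flip (k l i : 'I_3) : 'I_3 := 1 - k - l - i.

Lemma flipK k l : involutive (flip k l).
Proof. by move=> i; rewrite /flip; ring. Qed.

Lemma flipC k l : flip k l = flip l k.
Proof. by apply/funext => i; rewrite /flip; ring. Qed.

Lemma flip_opp k l : flip k l (- 1 - k) = - 1 - l.
Proof.
rewrite /flip (_ : 1 - k - l - (-1 - k) = 1 + 1 - l); last by ring.
by congr (_ - _); apply/val_inj.
Qed.

Lemma flip_start k l : flip k l (- k) = 1 - l.
Proof. by rewrite /flip; ring. Qed.

Lemma flip_end k l : flip k l (1 - k) = - l.
Proof. by rewrite /flip; ring. Qed.

Lemma mem_flip k l (J : {set 'I_3}) i : (i \in flip k l @: J) = (flip k l i \in J).
Proof. by rewrite -{1}(flipK k l i) mem_imset //; exact: can_inj (flipK k l). Qed.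

Lemma corner_cases (k i : 'I_3) : [\/ i = - k, i = 1 - k | i = - 1 - k].
Proof.
by case: k i => [[|[|[|//]]] hk] [[|[|[|//]]] hi];
  do ?[by apply: Or31; apply/val_inj | by apply: Or32; apply/val_inj | by apply: Or33; apply/val_inj].
Qed.

Lemma near_all (T : topologicalType) (x : T) (P : T -> Prop) :
  (forall y, P y) -> \forall y \near x, P y.
Proof. by move=> Py; apply: filterS filterT => y _. Qed.

Lemma flip_neq0 k l (J : {set 'I_3}) : J != finset.set0 -> flip k l @: J != finset.set0.
Proof. by rewrite -!cards_eq0 card_imset //; exact: can_inj (flipK k l). Qed.

(** * Open stars of the faces of a triangle *)

Section Cells.
Context {R : realType}.
Local Notation Δ2 := (simplex R 2).
Implicit Types (J : {set 'I_3}) (x y : Δ2).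

(* The open star, in the barycentric subdivision, of the barycentre of the face
   spanned by J. *)
Definition star J : set Δ2 :=
  [set x | J != finset.set0 /\ forall i, i \in J ->
    0 < bcoord x i /\ forall j, j \notin J -> bcoord x j < bcoord x i].

Definition support x : {set 'I_3} := [set i | bcoord x i != 0]%SET.

Lemma star_support x : star (support x) x.
Proof.
split.
  apply/eqP => s0; have := sum_bcoord x; rewrite big1 => [/eqP|i _].
    by rewrite eq_sym oner_eq0.
  by apply/eqP; have := finset.in_set0 i; rewrite -s0 inE => /negbFE.
move=> i; rewrite inE => xi; split; first by rewrite lt_neqAle eq_sym xi bcoord_ge0.
by move=> j; rewrite inE negbK => /eqP ->; rewrite lt_neqAle eq_sym xi bcoord_ge0.
Qed.

Lemma open_star J : open (star J).
Proof.
have [->|J0] := eqVneq J finset.set0.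
  rewrite (_ : star _ = set0); first exact: open0.
  by apply/seteqP; split => // x [] /=; rewrite eqxx.
rewrite openE => x [_ xJ].
have h (i : 'I_3) : \forall y \near x, i \in J ->
    0 < bcoord y i /\ forall j, j \notin J -> bcoord y j < bcoord y i.
  have [iJ|niJ] := boolP (i \in J); last by apply: near_all.
  have [xi xij] := xJ i iJ.
  have h1 : \forall y \near x, 0 < bcoord y i.
    apply: (@bcoord_continuous_simplex R 2 i x [set r | 0 < r]).
    exact: lt_nbhsr.
  have h2 (j : 'I_3) : \forall y \near x, j \notin J -> bcoord y j < bcoord y i.
    have [jJ|njJ] := boolP (j \in J); first by apply: near_all => y; rewrite /= ?jJ.
    have := xij j njJ; set xj := bcoord x j; set xi' := bcoord x i => ji.
    pose m := (xj + xi') / 2.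
    have n1 : \forall y \near x, bcoord y j < m.
      apply: (@bcoord_continuous_simplex R 2 j x [set r | r < m]).
      by apply: lt_nbhsl; rewrite /m -/xj; lra.
    have n2 : \forall y \near x, m < bcoord y i.
      apply: (@bcoord_continuous_simplex R 2 i x [set r | m < r]).
      by apply: lt_nbhsr; rewrite /m -/xi'; lra.
    by apply: filterS2 n1 n2 => y y1 y2 _; exact: lt_trans y1 y2.
  have h2' := @filter_forall _ _ (fun j => [set y : Δ2 | j \notin J -> bcoord y j < bcoord y i]) (nbhs x) (nbhs_filter x) h2.
  apply: (@filterS _ _ (nbhs_filter x) _ _ _ (filterI h1 h2')) => y [y1 y2] _; split=> // j; exact: y2.
have h' := @filter_forall _ _ (fun i => [set y : Δ2 | i \in J ->
    0 < bcoord y i /\ forall j, j \notin J -> bcoord y j < bcoord y i]) (nbhs x) (nbhs_filter x) h.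
by apply: filterS h' => y yJ; split.
Qed.

(** Coordinates in J exceed those outside J, so the faces whose stars contain x are nested, and
    equal size forces equality. A class of glued faces thus has at most one member in a given
    triangle whose star contains x. *)
Lemma star_comparable J J' x : star J x -> star J' x -> #|J| = #|J'| -> J = J'.
Proof.
move=> [_ xJ] [_ xJ'] cJ.
have [sJ|/subsetPn[a aJ aJ']] := boolP (J \subset J').
  by apply/eqP; rewrite eqEcard sJ cJ leqnn.
have [sJ|/subsetPn[b bJ' bJ]] := boolP (J' \subset J).
  by apply/esym/eqP; rewrite eqEcard sJ cJ leqnn.
have [_ /(_ b bJ) h1] := xJ a aJ; have [_ /(_ a aJ') h2] := xJ' b bJ'.
by have := lt_trans h1 h2; rewrite ltxx.
Qed.

Lemma star_seg J x y t : star J x -> star J y -> star J (seg x y t).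
Proof.
move=> [J0 xJ] [_ yJ]; split=> // i iJ.
have [x0 xi] := xJ i iJ; have [y0 yi] := yJ i iJ.
have conv (u v : R) : 0 < u -> 0 < v -> 0 < bcoord t ord0 * u + bcoord t ord_max * v.
  rewrite bcoord1E; set s := bcoord t ord_max => u0 v0.
  have s0 : 0 <= s := bcoord_ge0 _ _; have s1 : s <= 1 := bcoord_le1 _ _.
  by case: (lerP s (1 / 2)) => hs; nra.
split=> [|j jJ]; rewrite !bcoord_seg; first exact: conv.
rewrite -subr_gt0; have := conv _ _ (ltac:(rewrite subr_gt0; exact: xi) : 0 < bcoord x i - bcoord x j)
  (ltac:(rewrite subr_gt0; exact: yi) : 0 < bcoord y i - bcoord y j).
by rewrite !mulrBr; congr (_ < _); ring.
Qed.

Lemma star_flip k l J x y : (forall i, bcoord y i = bcoord x (flip k l i)) ->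
  star J x -> star (flip k l @: J) y.
Proof.
move=> yx [J0 xJ]; split; first exact: flip_neq0.
move=> i; rewrite mem_flip => iJ; have [x0 xi] := xJ _ iJ.
by rewrite yx; split=> // j; rewrite mem_flip yx; exact: xi.
Qed.

(** The empty face, whose star is empty, gets a corner as a default value so that the function is
    always a point of the simplex. *)
Definition barycentre_fun J (i : 'I_3) : R :=
  if J == finset.set0 then (i == ord0)%:R else (i \in J)%:R / #|J|%:R.

Lemma barycentre_ge0 J i : 0 <= barycentre_fun J i.
Proof. by rewrite /barycentre_fun; case: ifP => _; rewrite ?divr_ge0. Qed.

Lemma barycentre_sum J : \sum_i barycentre_fun J i = 1.
Proof.
rewrite /barycentre_fun; have [J0|J0] := eqVneq J finset.set0; first by rewrite vert_sum.
rewrite -mulr_suml -natr_sum -big_mkcond /= sum1_card divff //.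
by rewrite pnatr_eq0 cards_eq0.
Qed.

Definition barycentre J : Δ2 := mk_simplex (barycentre_ge0 J) (barycentre_sum J).

Lemma bcoord_barycentre J i : J != finset.set0 ->
  bcoord (barycentre J) i = (i \in J)%:R / #|J|%:R.
Proof. by move=> J0; rewrite bcoord_mk /barycentre_fun (negbTE J0). Qed.

Lemma barycentre_flip k l J i : J != finset.set0 ->
  bcoord (barycentre (flip k l @: J)) i = bcoord (barycentre J) (flip k l i).
Proof.
move=> J0; rewrite !bcoord_barycentre ?flip_neq0 // mem_flip card_imset //.
exact: can_inj (flipK k l).
Qed.

End Cells.

(** * Stars, contractions and potentials on a glued complex *)

Section GluedComplex.
Context {R : realType} {X : topologicalType} {n : nat}.
Local Notation Δ2 := (simplex R 2).
Variables (psi : 'I_n -> Δ2 -> X) (mate : 'I_n * 'I_3 -> 'I_n * 'I_3).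

Definition side_glued (p q : 'I_n * Δ2) := exists k l, [/\ mate (p.1, k) = (q.1, l),
  bcoord p.2 (- 1 - k) = 0 & forall i, bcoord q.2 i = bcoord p.2 (flip k l i)].

Hypothesis mateK : involutive mate.
Hypothesis psi_c : forall v, continuous (psi v).
Hypothesis psi_open : forall V : set X, (forall v, open (psi v @^-1` V)) -> open V.
Hypothesis psi_surj : forall p, exists v x, psi v x = p.
Hypothesis psi_glue : forall p q, side_glued p q -> psi p.1 p.2 = psi q.1 q.2.
Hypothesis psi_eq : forall p q, psi p.1 p.2 = psi q.1 q.2 ->
  clos_refl_sym_trans _ side_glued p q.

Lemma side_glued_sym p q : side_glued p q -> side_glued q p.
Proof.
move=> [k [l [pq p0 pqE]]]; exists l, k; split.
- by rewrite -pq mateK.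
- by rewrite pqE flipC flip_opp.
- by move=> i; rewrite pqE flipC flipK.
Qed.

Definition cell : finType := ('I_n * {set 'I_3})%type.

(** The condition [- 1 - k \notin c.2] says that the face lies on the k-th side. The classes
    generated by this relation on nonempty faces are the vertices, edges and triangles of the glued
    complex. *)
Definition cell_glued (c d : cell) : bool :=
  [exists k, exists l, [&& mate (c.1, k) == (d.1, l), - 1 - k \notin c.2 &
    d.2 == flip k l @: c.2]].

Lemma cell_gluedP (c d : cell) : reflect (exists k l, [/\ mate (c.1, k) = (d.1, l),
    - 1 - k \notin c.2 & d.2 = flip k l @: c.2]) (cell_glued c d).
Proof.
apply: (iffP existsP) => [[k /existsP[l /and3P[/eqP h1 h2 /eqP h3]]]|[k [l [h1 h2 h3]]]].
  by exists k, l.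
by exists k; apply/existsP; exists l; rewrite h1 h2 h3 !eqxx.
Qed.

Lemma connect_card c d : connect cell_glued c d -> #|c.2| = #|d.2|.
Proof.
case/connectP => s + ->; elim: s c => [//|c' s IH] c /= /andP[cc' /IH <-].
case/cell_gluedP: cc' => k [l [_ _ ->]]; rewrite card_imset //.
exact: can_inj (flipK k l).
Qed.

Definition cell_star (c : cell) : set X := [set p | exists v x J,
  [/\ psi v x = p, connect cell_glued c (v, J) & star J x]].

Section Descend.
Variables (T : Type) (d : X -> T) (g : 'I_n -> {set 'I_3} -> Δ2 -> T).
Hypothesis g_glued : forall v w k l (J : {set 'I_3}) (x y : Δ2), mate (v, k) = (w, l) -> - 1 - k \notin J ->
  bcoord x (- 1 - k) = 0 -> (forall i, bcoord y i = bcoord x (flip k l i)) ->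
  star J x -> g v J x = g w (flip k l @: J) y.

Let rep c (r : T) (p : 'I_n * Δ2) := exists J,
  [/\ connect cell_glued c (p.1, J), star J p.2 & r = g p.1 J p.2].

Let rep_glued c r p q : side_glued p q -> rep c r p -> rep c r q.
Proof.
case: p q => [v x] [w y] [k [l /= [mk x0 xy]]] [J /= [cJ xJ ->]].
have kJ : - 1 - k \notin J.
  by apply/negP => kJ; have [_ /(_ _ kJ)[]] := xJ; rewrite x0 ltxx.
exists (flip k l @: J); split => /=.
- apply: connect_trans cJ _; apply/connect1/cell_gluedP; by exists k, l.
- exact: star_flip xJ.
- exact: g_glued.
Qed.

Let rep_psi c r p q : psi p.1 p.2 = psi q.1 q.2 -> rep c r p <-> rep c r q.
Proof.
move=> /psi_eq; elim=> {p q} [p q pq|p|p q _ <-|p q s _ -> _ ->] //.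
by split; apply: rep_glued => //; exact: side_glued_sym.
Qed.

(** A function on a star of X is read off a formula [g] in any chart, with [d] as the value off the
    star. The same construction yields the contractions, whose values are paths, and the potentials,
    whose values are numbers. *)
Definition descend (c : cell) (p : X) : T :=
  match pselect (exists r, exists v x J, [/\ psi v x = p,
    connect cell_glued c (v, J), star J x & r = g v J x]) with
  | left h => sval (cid h)
  | right _ => d p
  end.

Lemma descendE c v J x : connect cell_glued c (v, J) -> star J x ->
  descend c (psi v x) = g v J x.
Proof.
move=> cJ xJ; rewrite /descend; case: pselect => [h|[]]; last first.
  by exists (g v J x), v, x, J.
have [w [y [J' [yx cJ' yJ' ->]]]] := svalP (cid h).
have : rep c (g w J' y) (v, x) by apply/(@rep_psi _ _ (v, x) (w, y)) => //; exists J'.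
case=> J2 /= [cJ2 xJ2 ->]; suff -> : J2 = J by [].
by apply: (star_comparable xJ2 xJ); rewrite -(connect_card cJ2) -(connect_card cJ).
Qed.

End Descend.

(** Membership in a star travels along the gluings, so it can be tested in whichever chart
    represents the point. *)
Lemma cell_starE c v x : cell_star c (psi v x) ->
  exists J, connect cell_glued c (v, J) /\ star J x.
Proof.
move=> [w [y [J [yx cJ yJ]]]].
suff : forall p q, clos_refl_sym_trans _ side_glued p q ->
    (exists J, connect cell_glued c (p.1, J) /\ star J p.2) <->
    (exists J, connect cell_glued c (q.1, J) /\ star J q.2).
  move=> /(_ (w, y) (v, x) (@psi_eq (w, y) (v, x) yx))[h _]; by apply: h; exists J.
move=> p q; elim=> {v x w y J yx cJ yJ p q} [p q pq|p|p q _ <-|p q s _ -> _ ->] //.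
suff st p' q' : side_glued p' q' -> (exists J, connect cell_glued c (p'.1, J) /\ star J p'.2) ->
    (exists J, connect cell_glued c (q'.1, J) /\ star J q'.2).
  by split; apply: st => //; exact: side_glued_sym.
case: p' q' => [v x] [w y] [k [l /= [mk x0 xy]]] [J /= [cJ xJ]].
exists (flip k l @: J); split => /=; last exact: star_flip xJ.
apply: connect_trans cJ _; apply/connect1/cell_gluedP; exists k, l; split=> //=.
by apply/negP => kJ; have [_ /(_ _ kJ)[]] := xJ; rewrite x0 ltxx.
Qed.

Lemma cell_star_psi c v x J : connect cell_glued c (v, J) -> star J x -> cell_star c (psi v x).
Proof. by move=> cJ xJ; exists v, x, J. Qed.

Lemma open_cell_star c : open (cell_star c).
Proof.
apply: psi_open => v; rewrite openE => x /= /cell_starE[J [cJ xJ]].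
have := open_nbhs_nbhs (conj (@open_star R J) xJ).
by apply: filterS => y yJ; exact: cell_star_psi cJ yJ.
Qed.

Lemma cell_star_cover p : exists c, cell_star c p.
Proof.
have [v [x <-]] := psi_surj p; exists (v, support x).
exact: cell_star_psi (connect0 _ _) (star_support x).
Qed.

Lemma cell_star_nbhs (p : X) : exists c, nbhs p (cell_star c).
Proof.
by have [c cp] := cell_star_cover p; exists c; apply: open_nbhs_nbhs; split=> //; exact: open_cell_star.
Qed.

Definition cell_contraction : cell -> X -> simplex R 1 -> X :=
  descend (fun p _ => p) (fun v J x t => psi v (seg (barycentre J) x t)).

Lemma cell_contractionE c v J x : connect cell_glued c (v, J) -> star J x ->
  cell_contraction c (psi v x) = fun t => psi v (seg (barycentre J) x t).
Proof.
apply: (@descendE _ (fun p _ => p) (fun v J x t => psi v (seg (barycentre J) x t))).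
move=> v' w k l J' x' y mk kJ x0 xy [J0 _]; apply/funext => t.
apply: (psi_glue (p := (v', _)) (q := (w, _))); exists k, l; split => //=.
  by rewrite bcoord_seg x0 bcoord_barycentre // (negbTE kJ) mul0r !mulr0 addr0.
by move=> i; rewrite !bcoord_seg xy barycentre_flip.
Qed.

Lemma psi_barycentre c d : connect cell_glued c d -> c.2 != finset.set0 ->
  psi d.1 (barycentre d.2) = psi c.1 (barycentre c.2).
Proof.
case/connectP => s + ->; elim: s c => [//|c' s IH] c /= /andP[cc' cs] c0.
case/cell_gluedP: (cc') => k [l [mk kc c'E]].
rewrite IH //; last by rewrite c'E flip_neq0.
apply/esym/(psi_glue (p := (_, _)) (q := (_, _))); exists k, l; split => //=.
  by rewrite bcoord_barycentre // (negbTE kc) mul0r.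
by move=> i; rewrite c'E barycentre_flip.
Qed.

Lemma cell_contraction_start c p : cell_star c p ->
  cell_contraction c p (vert ord0) = psi c.1 (barycentre c.2).
Proof.
move=> [v [x [J [<- cJ xJ]]]]; rewrite (cell_contractionE cJ xJ) seg0.
apply: (psi_barycentre cJ); have [J0 _] := xJ.
by rewrite -cards_eq0 (connect_card cJ) cards_eq0.
Qed.

Lemma cell_contraction_end c p : cell_star c p -> cell_contraction c p (vert ord_max) = p.
Proof. by move=> [v [x [J [<- cJ xJ]]]]; rewrite (cell_contractionE cJ xJ) seg1. Qed.

Lemma seg_joint_continuous (a : Δ2) :
  continuous (fun z : Δ2 * simplex R 1 => seg a z.1 z.2).
Proof.
apply: simplex_continuous => i.
have -> : (fun z : Δ2 * simplex R 1 => bcoord (seg a z.1 z.2) i) =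
    (fun z : Δ2 * simplex R 1 => bcoord z.2 ord0 * bcoord a i + bcoord z.2 ord_max * bcoord z.1 i).
  by apply/funext => z; rewrite bcoord_seg.
have c2 k : continuous (fun z : Δ2 * simplex R 1 => bcoord z.2 k).
  move=> z; apply: (@continuous_comp _ _ _ snd (fun t : simplex R 1 => bcoord t k)).
    exact: cvg_snd.
  exact: bcoord_continuous_simplex.
have c1 k : continuous (fun z : Δ2 * simplex R 1 => bcoord z.1 k).
  move=> z; apply: (@continuous_comp _ _ _ fst (fun t : Δ2 => bcoord t k)).
    exact: cvg_fst.
  exact: bcoord_continuous_simplex.
have h1 : continuous (fun z : Δ2 * simplex R 1 => bcoord z.2 ord0 * bcoord a i).
  by apply: continuous_mul => // z; exact: cvg_cst.
have h2 : continuous (fun z : Δ2 * simplex R 1 => bcoord z.2 ord_max * bcoord z.1 i).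
  exact: continuous_mul.
by move=> z; apply: cvgD; [exact: h1|exact: h2].
Qed.

(** In a chart the contraction is an affine segment to the barycentre, clearly continuous in both
    variables; the passage to the quotient X is the theorem of Whitehead above. *)
Lemma cell_contraction_continuous c p t : cell_star c p ->
  {for (p, t), continuous (fun z : X * simplex R 1 => cell_contraction c z.1 z.2)}.
Proof.
apply: (quotient_joint_continuity psi_c psi_open psi_surj (@simplex_locally_compact R 1)).
  exact: open_cell_star.
move=> v x s /cell_starE[J [cJ xJ]] B /= nB.
rewrite (cell_contractionE cJ xJ) in nB.
have n1 : nbhs (x, s) (fun z : Δ2 * simplex R 1 => B (psi v (seg (barycentre J) z.1 z.2))).
  have := @continuous_comp _ _ _ (fun z : Δ2 * simplex R 1 => seg (barycentre J) z.1 z.2) (psi v) (x, s).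
  by apply => //; [exact: seg_joint_continuous|exact: psi_c].
have n2 : nbhs (x, s) (fun z : Δ2 * simplex R 1 => star J z.1).
  exact: (@cvg_fst _ _ (nbhs x) (nbhs s) _ _ (open_nbhs_nbhs (conj (@open_star R J) xJ))).
by apply: filterS2 n1 n2 => -[y u] /= By yJ; rewrite (cell_contractionE cJ yJ).
Qed.

Lemma cell_cocycle c (z : cochain R X 1) (f : simplex R 1 -> X) : cocycles z ->
  continuous f -> (forall t, cell_star c (f t)) ->
  ceval z f = ceval z (cell_contraction c (f (vert ord_max))) - ceval z (cell_contraction c (f (vert ord0))).
Proof.
apply: contraction_cocycle.
- by move=> p t; exact: cell_contraction_continuous.
- exact: cell_contraction_start.
- exact: cell_contraction_end.
Qed.

(* The jumps between the primitives of a cocycle on two stars, measured at one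
   point of each of their convex overlaps. *)
Definition overlap_index : finType := ('I_n * {set 'I_3} * {set 'I_3})%type.

Definition overlap_jump (k : overlap_index) (z : cochain R X 1) : R :=
  let p := psi k.1.1 (xget (vert ord0) (star k.1.2 `&` star k.2)) in
  ceval z (cell_contraction (k.1.1, k.1.2) p) - ceval z (cell_contraction (k.1.1, k.2) p).

Lemma overlap_jump_linear k : linear_functional (overlap_jump k).
Proof.
move=> I a z; rewrite /overlap_jump !ceval_sum -sumrB.
by apply: eq_bigr => i _; rewrite mulrBr.
Qed.

Lemma overlap_jump0 (z : cochain R X 1) : cocycles z ->
  (forall k, overlap_jump k z = 0) -> coboundaries z.
Proof.
move=> zc z0.
have agree c d p : cell_star c p -> cell_star d p ->
    ceval z (cell_contraction c p) = ceval z (cell_contraction d p).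
  have [v [x <-]] := psi_surj p.
  move=> /cell_starE[J [cJ xJ]] /cell_starE[J' [dJ' xJ']].
  rewrite (cell_contractionE cJ xJ) (cell_contractionE dJ' xJ').
  (* The contraction path at a point depends only on the triangle v and the face there, so c and d
     may be replaced by faces of v. This is why finitely many overlaps suffice. *)
  rewrite -(cell_contractionE (connect0 _ _) xJ) -(cell_contractionE (connect0 _ _) xJ').
  have := z0 (v, J, J'); rewrite /overlap_jump /=.
  case: xgetP => [m _ [mJ mJ']|/(_ x) []] //.
  (* The overlap of two stars in a triangle is convex. Both primitives grow by the value of z on the
     segment from m to x, so their difference at x is the one at m, namely zero. *)
  have mxc : continuous (psi v \o seg m x).
    by move=> t; apply: continuous_comp; [exact: seg_continuous|exact: psi_c].
  have h1 : forall t, cell_star (v, J) ((psi v \o seg m x) t).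
    by move=> t; apply: cell_star_psi (connect0 _ _) _; exact: star_seg.
  have h2 : forall t, cell_star (v, J') ((psi v \o seg m x) t).
    by move=> t; apply: cell_star_psi (connect0 _ _) _; exact: star_seg.
  have := cell_cocycle zc mxc h1; have := cell_cocycle zc mxc h2.
  by rewrite /= !seg0 !seg1; lra.
have [k kP] := choice cell_star_cover.
apply: (coboundary_small cell_star_nbhs (b := fun p => ceval z (cell_contraction (k p) p)) zc).
move=> c f fc fU; rewrite (cell_cocycle zc fc fU).
by congr (_ - _); exact: agree.
Qed.

(** * Cocycles from corner values with matching increments *)

Section Potentials.
Variable P : 'I_n * 'I_3 -> R.
Hypothesis P_glued : forall v k w l, mate (v, k) = (w, l) ->
  P (v, 1 - k) - P (v, - k) = P (w, - l) - P (w, 1 - l).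

Definition pl_fun v (x : Δ2) : R := \sum_i bcoord x i * P (v, i).

Lemma pl_fun_vert v i : pl_fun v (vert i) = P (v, i).
Proof.
rewrite /pl_fun (bigD1 i) //= bcoord_vert eqxx mul1r big1 ?addr0 // => j /negbTE ji.
by rewrite bcoord_vert ji mul0r.
Qed.

(** Two affine functions with the same increment along the glued side differ there by a constant.
    This constant is left free: it is the jump that can make the resulting cocycle nontrivial. *)
Lemma pl_fun_glued v k w l x y : mate (v, k) = (w, l) -> bcoord x (- 1 - k) = 0 ->
  (forall i, bcoord y i = bcoord x (flip k l i)) ->
  pl_fun v x - pl_fun w y = P (v, - k) - P (w, 1 - l).
Proof.
move=> mk x0 xy.
have -> : pl_fun w y = \sum_i bcoord x i * P (w, flip k l i).
  rewrite /pl_fun (reindex_inj (can_inj (flipK k l))) /=.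
  by apply: eq_bigr => i _; rewrite xy flipK.
rewrite /pl_fun -sumrB -[RHS]mul1r -(sum_bcoord x) mulr_suml.
apply: eq_bigr => i _; rewrite -mulrBr.
have [->|->|->] := corner_cases k i; last by rewrite x0 !mul0r.
  by rewrite flip_start.
by rewrite flip_end; congr (_ * _); have := P_glued mk; lra.
Qed.

(* The constant makes the potential vanish at the centre of the star, where it
   would otherwise depend on the triangle. *)
Definition pl_potential : cell -> X -> R :=
  descend (fun=> 0) (fun v J x => pl_fun v x - pl_fun v (barycentre J)).

Lemma pl_potentialE c v J x : connect cell_glued c (v, J) -> star J x ->
  pl_potential c (psi v x) = pl_fun v x - pl_fun v (barycentre J).
Proof.
apply: (@descendE _ (fun=> 0) (fun v J x => pl_fun v x - pl_fun v (barycentre J))).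
move=> v' w k l J' x' y mk kJ x0 xy [J0 _].
have h1 := pl_fun_glued mk x0 xy.
have h2 : pl_fun v' (barycentre J') - pl_fun w (barycentre (flip k l @: J')) =
    P (v', - k) - P (w, 1 - l).
  apply: (pl_fun_glued mk).
    by rewrite bcoord_barycentre // (negbTE kJ) mul0r.
  by move=> i; rewrite barycentre_flip.
by lra.
Qed.

(** Inside one triangle both potentials are the same affine function up to constants; the set where
    the difference keeps its value is open because it is open in each chart. *)
Lemma pl_potential_loc c d p : cell_star c p -> cell_star d p ->
  \forall q \near p, cell_star c q -> cell_star d q ->
    pl_potential c q - pl_potential d q = pl_potential c p - pl_potential d p.
Proof.
move=> cp dp.
pose V := [set q | [/\ cell_star c q, cell_star d q &
    pl_potential c q - pl_potential d q = pl_potential c p - pl_potential d p]].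
have oV : open V.
  apply: psi_open => v; rewrite openE => x [/= /cell_starE[J [cJ xJ]] /cell_starE[J' [dJ xJ']] E].
  have n1 := open_nbhs_nbhs (conj (@open_star R J) xJ).
  have n2 := open_nbhs_nbhs (conj (@open_star R J') xJ').
  apply: filterS2 n1 n2 => y yJ yJ'; split.
  - exact: cell_star_psi cJ yJ.
  - exact: cell_star_psi dJ yJ'.
  - rewrite -E (pl_potentialE cJ xJ) (pl_potentialE cJ yJ).
    by rewrite (pl_potentialE dJ xJ') (pl_potentialE dJ yJ'); lra.
have Vp : V p by [].
by apply: filterS (open_nbhs_nbhs (conj oV Vp)) => q [].
Qed.

Lemma pl_fun_primitive v : primitive cell_star pl_potential (psi v) (pl_fun v).
Proof.
move=> a; exists (v, support a).
have := open_nbhs_nbhs (conj (@open_star R _) (star_support a)).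
apply: filterS => y ya; split; first exact: cell_star_psi (connect0 _ _) ya.
rewrite (pl_potentialE (connect0 _ _) ya) (pl_potentialE (connect0 _ _) (star_support a)).
by lra.
Qed.

Lemma pl_cocycle : exists2 c : cochain R X 1, cocycles c &
  forall v i j, ceval c (psi v \o seg (vert i) (vert j)) = P (v, j) - P (v, i).
Proof.
have [c cc cP] := potential_cocycle cell_star_nbhs pl_potential_loc.
exists c => // v i j.
rewrite (cP _ (pl_fun v \o seg (vert i) (vert j))).
- by rewrite /= seg0 seg1 !pl_fun_vert.
- by move=> t; apply: continuous_comp; [exact: seg_continuous|exact: psi_c].
- by apply: primitive_comp; [exact: seg_continuous|exact: pl_fun_primitive].
Qed.

End Potentials.

(** If a combination of the cocycles is the coboundary of b, then on each triangle the combined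
    corner values agree with b at the corners up to a constant. Here B is b at the corners, which
    the gluing identifies, and r collects the constants of the triangles. *)
Lemma pl_independent (I : finType) (P : I -> 'I_n * 'I_3 -> R) :
  (forall q v k w l, mate (v, k) = (w, l) ->
    P q (v, 1 - k) - P q (v, - k) = P q (w, - l) - P q (w, 1 - l)) ->
  (forall (a : I -> R) (B : 'I_n * 'I_3 -> R) (r : 'I_n -> R),
    (forall v k w l, mate (v, k) = (w, l) -> B (v, - k) = B (w, 1 - l)) ->
    (forall v i, \sum_q a q * P q (v, i) = B (v, i) + r v) ->
    forall q, a q = 0) ->
  exists w : I -> cochain R X 1, independent w.
Proof.
move=> Pg Pi.
have /choice[w wP] : forall q, exists c : cochain R X 1, cocycles c /\
    forall v i j, ceval c (psi v \o seg (vert i) (vert j)) = P q (v, j) - P q (v, i).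
  by move=> q; have [c cc cP] := pl_cocycle (Pg q); exists c.
exists w; split=> [q|a [b bP]]; first by have [] := wP q.
pose B0 (p : X) := ceval b (fun=> p).
have E v i j : \sum_q a q * (P q (v, j) - P q (v, i)) =
    B0 (psi v (vert j)) - B0 (psi v (vert i)).
  have fc : continuous (psi v \o seg (vert i) (vert j)).
    by move=> t; apply: continuous_comp; [exact: seg_continuous|exact: psi_c].
  transitivity (ceval (fun s => \sum_q a q * w q s) (psi v \o seg (vert i) (vert j))).
    by rewrite ceval_sum; apply: eq_bigr => q _; rewrite (wP q).2.
  rewrite -[_ \o _]/(mkcts fc : _ -> _) ceval_simplex bP coboundaryE.
  rewrite !big_ord_recl big_ord0 /= expr0 expr1 addr0 mul1r mulN1r /mkcts /B0.
  have pt (x : simplex R 0) : x = vert ord0.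
    apply: bcoord_inj => k; rewrite (ord1 k) bcoord_vert eqxx.
    by rewrite -(sum_bcoord x) big_ord_recl big_ord0 addr0.
  congr (ceval b _ - ceval b _); apply/funext => x /=; congr psi.
    rewrite (pt x) face_mapE aff_vert.
    by rewrite (_ : lift _ _ = ord_max) ?seg1 //; apply/val_inj.
  rewrite (pt x) face_mapE aff_vert.
  by rewrite (_ : lift _ _ = ord0) ?seg0 //; apply/val_inj.
apply: (Pi a (fun s => B0 (psi s.1 (vert s.2)))
   (fun v => \sum_q a q * P q (v, ord0) - B0 (psi v (vert ord0)))).
  move=> v k u l mk /=; congr B0.
  apply: (psi_glue (p := (v, _)) (q := (u, _))); exists k, l; split=> //=.
    rewrite bcoord_vert (_ : (_ == _) = false) //.
    by apply/negbTE/negP => /eqP/(congr1 (fun x => x + k)); rewrite subrK addNr.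
  move=> i; rewrite !bcoord_vert -(flip_start k l); congr (_ %:R).
  by rewrite -{1}(flipK k l i) (inj_eq (can_inj (flipK k l))).
move=> v i /=; have := E v ord0 i.
have -> : \sum_q a q * (P q (v, i) - P q (v, ord0)) =
    \sum_q a q * P q (v, i) - \sum_q a q * P q (v, ord0).
  by rewrite -sumrB; apply: eq_bigr => q _; rewrite mulrBr.
lra.
Qed.

Lemma finite_components : finite_set (@components X).
Proof.
have -> : @components X = (fun v => connected_component [set: X] (psi v (vert ord0))) @` [set: 'I_n].
  apply/seteqP; split=> [_ [p _ <-]|_ [v _ <-]]; last by exists (psi v (vert ord0)).
  have [v [x <-]] := psi_surj p; exists v => //.
  apply: same_connected_component.
  apply: (@connected_component_max _ _ (psi v @` [set: Δ2])).
  - by exists (vert ord0).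
  - by [].
  - apply: connected_continuous_connected; first exact: connected_simplex.
    exact: continuous_subspaceT.
  - by exists x.
exact: finite_image.
Qed.

(** There are n * 8 * 8 triples of a triangle and two sets of corners, and the genus is half of the
    Betti number. *)
Lemma glued_genus_le : total_genus R X <= 32 * n%:R.
Proof.
apply: (le_trans (total_genus_le finite_components overlap_jump_linear overlap_jump0)).
rewrite !card_prod card_ord (_ : #|{: {set 'I_3}}| = 8); last first.
  by rewrite -cardsT -powersetT card_powerset cardsT card_ord.
by rewrite !natrM; lra.
Qed.

Lemma glued_genus_ge (I : finType) (P : I -> 'I_n * 'I_3 -> R) :
  (forall q v k w l, mate (v, k) = (w, l) ->
    P q (v, 1 - k) - P q (v, - k) = P q (w, - l) - P q (w, 1 - l)) ->
  (forall (a : I -> R) (B : 'I_n * 'I_3 -> R) (r : 'I_n -> R),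
    (forall v k w l, mate (v, k) = (w, l) -> B (v, - k) = B (w, 1 - l)) ->
    (forall v i, \sum_q a q * P q (v, i) = B (v, i) + r v) ->
    forall q, a q = 0) ->
  #|I|%:R / 2 <= total_genus R X.
Proof.
move=> Pg Pi; have [w wi] := pl_independent Pg Pi.
exact: total_genus_ge finite_components overlap_jump_linear overlap_jump0 wi.
Qed.

End GluedComplex.

(** * Lower bound by the Euler characteristic *)

Lemma sum_enum_val (V : nmodType) (S : finType) (f : S -> V) :
  \sum_s f s = \sum_(i < #|S|) f (enum_val i).
Proof. by rewrite (reindex (@enum_val S S)) //=; exact/onW_bij/enum_val_bij. Qed.

(** Rank and nullity: the solutions of the equations M form a space of dimension at least |S| - |E|,
    and P is a basis of a complement in it of its intersection with the span of N. *)
Lemma solutions_modulo (F : fieldType) (S E Q : finType) (M : S -> E -> F) (N : Q -> S -> F) :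
  exists (I : finType) (P : I -> S -> F), [/\ (#|S| <= #|I| + #|E| + #|Q|)%N,
    forall i e, \sum_s P i s * M s e = 0 &
    forall (a : I -> F) (b : Q -> F),
      (forall s, \sum_i a i * P i s = \sum_q b q * N q s) -> forall i, a i = 0].
Proof.
pose A : 'M[F]_(#|S|, #|E|) := \matrix_(i, j) M (enum_val i) (enum_val j).
pose B : 'M[F]_(#|Q|, #|S|) := \matrix_(i, j) N (enum_val i) (enum_val j).
pose D := (kermx A :\: B)%MS.
exists 'I_(\rank D), (fun i s => row_base D i (enum_rank s)); split.
- rewrite card_ord.
  have := mxrank_cap_compl (kermx A) B; rewrite mxrank_ker -/D.
  have := rank_leq_col A; have := rank_leq_row B.
  have := mxrankS (capmxSr (kermx A) B).
  lia.
- move=> i e.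
  have : (row i (row_base D) <= kermx A)%MS.
    by rewrite (submx_trans (row_sub _ _)) // eq_row_base diffmxSl.
  move/sub_kermxP/(congr1 (fun v : 'rV_ _ => v ord0 (enum_rank e))); rewrite !mxE => h.
  rewrite -[RHS]h sum_enum_val; apply: eq_bigr => k _.
  by rewrite !mxE enum_valK enum_rankK.
- move=> a b ab i.
  pose u : 'rV[F]_(\rank D) := \row_i a i.
  suff : u == 0 by move/eqP/rowP/(_ i); rewrite !mxE.
  rewrite -(mulmx_free_eq0 _ (row_base_free D)) -submx0 -(capmx_diff (kermx A) B) sub_capmx.
  rewrite (submx_trans (submxMl _ _)) ?eq_row_base //=.
  suff -> : u *m row_base D = (\row_q b (enum_val q)) *m B by exact: submxMl.
  apply/rowP => s; rewrite !mxE.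
  transitivity (\sum_i a i * row_base D i (enum_rank (enum_val s))).
    by apply: eq_bigr => k _; rewrite !mxE enum_valK.
  by rewrite ab sum_enum_val; apply: eq_bigr => k _; rewrite !mxE.
Qed.

Section EulerBound.
Context {R : realType} {X : topologicalType} {n : nat}.
Local Notation Δ2 := (simplex R 2).
Variables (psi : 'I_n -> Δ2 -> X) (mate : 'I_n * 'I_3 -> 'I_n * 'I_3).
Hypothesis mateK : involutive mate.
Hypothesis psi_c : forall v, continuous (psi v).
Hypothesis psi_open : forall V : set X, (forall v, open (psi v @^-1` V)) -> open V.
Hypothesis psi_surj : forall p, exists v x, psi v x = p.
Hypothesis psi_glue : forall p q, side_glued mate p q -> psi p.1 p.2 = psi q.1 q.2.
Hypothesis psi_eq : forall p q, psi p.1 p.2 = psi q.1 q.2 ->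
  clos_refl_sym_trans _ (side_glued mate) p q.

(** Side k starts at the corner - k, which is glued to the corner 1 - l of the mate; this corner
    starts the side l - 1. The orbits thus go around the cusps. *)
Definition next_side (s : 'I_n * 'I_3) := ((mate s).1, (mate s).2 - 1).

Variables (E Q : finType) (edge : 'I_n * 'I_3 -> E) (cusp : 'I_n * 'I_3 -> Q).
Hypothesis mate_neq : forall s, mate s != s.
Hypothesis edgeP : forall s t, (edge t == edge s) = (t == s) || (t == mate s).
Hypothesis cuspP : forall s t, cusp s = cusp t -> exists m, t = iter m next_side s.

(** The unknowns are the 3n corner values, with one equation per edge. The solutions to be discarded
    are sums of a function of the cusp and a function of the triangle, by [pl_independent]. *)
Lemma glued_genus_euler :
  ((3 * n)%:R - #|E|%:R - #|Q|%:R - n%:R) / 2 <= total_genus R X.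
Proof.
pose dP (P : 'I_n * 'I_3 -> R) (t : 'I_n * 'I_3) := P (t.1, 1 - t.2) - P (t.1, - t.2).
pose M (s : 'I_n * 'I_3) (e : E) : R :=
  \sum_(t | edge t == e) ((s == (t.1, 1 - t.2))%:R - (s == (t.1, - t.2))%:R).
(* The corner i starts the side - i, hence the cusp of a corner is that of the side with opposite
   index. *)
pose N (q : Q + 'I_n) (s : 'I_n * 'I_3) : R :=
  match q with inl q => (cusp (s.1, - s.2) == q)%:R | inr v => (s.1 == v)%:R end.
have [I [P [cI PM PN]]] := solutions_modulo M N.
have dM (p : 'I_n * 'I_3 -> R) e : \sum_s p s * M s e = \sum_(t | edge t == e) dP p t.
  under eq_bigr do rewrite mulr_sumr.
  rewrite exchange_big; apply: eq_bigr => t _ /=.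
  have pick1 (u : 'I_n * 'I_3) : \sum_s p s * (s == u)%:R = p u.
    rewrite (bigD1 u) //= eqxx mulr1 big1 ?addr0 // => s /negbTE ->.
    by rewrite mulr0.
  under eq_bigr do rewrite mulrBr.
  by rewrite sumrB !pick1.
apply: le_trans (@glued_genus_ge _ _ _ psi mate mateK psi_c psi_open psi_surj psi_glue psi_eq I P _ _).
- rewrite ler_pM2r ?invr_gt0 //; move: cI.
  rewrite card_prod card_sum !card_ord -(ler_nat R) !natrD !natrM; lra.
- move=> q v k w l mk; have := PM q (edge (v, k)); rewrite dM.
  rewrite (bigD1 (v, k)) ?eqxx //= (bigD1 (mate (v, k))); last first.
    by rewrite mate_neq edgeP eqxx orbT.
  rewrite big1 => [|t]; last by rewrite edgeP => /andP[/andP[/orP[/eqP->|/eqP->]]]; rewrite ?eqxx.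
  by rewrite /dP mk /=; lra.
(* B is constant around a cusp, because crossing an edge preserves it at the starting corner, so its
   value may be read off any side with the given label; 0 is the value at labels of no side. *)
- move=> a B r Bm aP; apply: (PN a (fun q => match q with
     | inl q => if [pick s | cusp s == q] is Some s then B (s.1, - s.2) else 0
     | inr v => r v end)) => -[v i].
  rewrite aP big_sumType /=; congr (_ + _); last first.
    by rewrite (bigD1 v) //= eqxx mulr1 big1 ?addr0 // => w; rewrite eq_sym => /negbTE ->; rewrite mulr0.
  rewrite (bigD1 (cusp (v, - i))) //= eqxx mulr1 big1 ?addr0; last first.
    by move=> w; rewrite eq_sym => /negbTE ->; rewrite mulr0.
  case: pickP => [s /eqP/esym/cuspP[m ->]|/(_ (v, - i))]; last by rewrite eqxx.
  rewrite -{1}(opprK i) -[RHS]/((fun s => B (s.1, - s.2)) (iter m next_side (v, - i))).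
  elim: m => //= m ->; case: (iter m _ _) => w k.
  rewrite /next_side /= (Bm _ _ _ _ (surjective_pairing (mate (w, k)))).
  by congr (B (_, _)); rewrite opprB.
Qed.

End EulerBound.

(** * The Klein model of the ideal triangle *)

Section KleinModel.
Context {R : realType}.
Local Notation Δ2 := (simplex R 2).
Local Notation sphere := (riemann_sphere R).

Definition sqnorm (z : R[i]) : R := complex.Re z ^+ 2 + complex.Im z ^+ 2.

(** The sum of |z|^2 - Re z, 1 - Re z and Re z, whose zero sets are the geodesics carrying the three
    sides; it is positive on the whole plane, so it can normalize them. *)
Definition weight (z : R[i]) : R := sqnorm z + 1 - complex.Re z.

(* Barycentric coordinates, with respect to oo, 0 and 1, of the point that
   represents z in the Klein model, where geodesics are straight lines. *)
Definition klein (p : sphere) (i : 'I_3) : R :=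
  match p with
  | None => (i == ord0)%:R
  | Some z => (if i == ord0 then sqnorm z - complex.Re z
               else if i == 1 then 1 - complex.Re z else complex.Re z) / weight z
  end.

Lemma weight_gt0 z : 0 < weight z.
Proof. by rewrite /weight /sqnorm; nra. Qed.

Lemma sum_klein p : \sum_i klein p i = 1.
Proof.
case: p => [z|]; last exact: vert_sum.
have := weight_gt0 z; rewrite !big_ord_recl big_ord0 /= => w0.
by rewrite addr0 -!mulrDl -[RHS](@mulfV _ (weight z)) ?gt_eqF //; congr (_ / _); rewrite /weight; ring.
Qed.

Lemma ord3P (P : 'I_3 -> Prop) : P ord0 -> P 1 -> P (1 + 1) -> forall i, P i.
Proof.
move=> P0 P1 P2 i; have [|[|]] : i = ord0 \/ i = 1 \/ i = 1 + 1; try by move=> ->.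
by case: i => [[|[|[|//]]] hi]; [left|right; left|right; right]; apply/val_inj.
Qed.

Lemma rotationE (z : R[i]) : z != 0 -> exists w : R[i], rotation (Some z : sphere) = Some w /\
  [/\ complex.Re w * sqnorm z = sqnorm z - complex.Re z,
      complex.Im w * sqnorm z = complex.Im z,
      sqnorm w * sqnorm z = sqnorm z - 2 * complex.Re z + 1 & 0 < sqnorm z].
Proof.
move=> z0; exists ((z - 1) / z); split; first by rewrite /rotation (negbTE z0).
case: z z0 => a b; rewrite eq_complex /= negb_and => ab.
have n0 : 0 < a ^+ 2 + b ^+ 2.
  by case/orP: ab => h; [rewrite ltr_pwDl|rewrite ltr_wpDl]; rewrite ?sqr_ge0 // exprn_even_gt0.
rewrite /sqnorm /=; split=> //=; field; exact: lt0r_neq0.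
Qed.

Lemma klein_rotation (p : sphere) i : klein (rotation p) i = klein p (i + 1).
Proof.
case: p => [z|]; last first.
  by rewrite /= /weight /sqnorm /=; elim/ord3P: i => /=; rewrite ?expr0n /= ?expr1n; field.
have [->|z0] := eqVneq z 0.
  rewrite /rotation eqxx /klein /weight /sqnorm !raddf0 !expr0n /=.
  by elim/ord3P: i => /=; field.
have [w [-> [h1 h2 h3 n0]]] := rotationE z0.
have w0 := weight_gt0 w; have wz := weight_gt0 z.
have hw : weight w * sqnorm z = weight z.
  by rewrite /weight mulrBl mulrDl h1 h3; ring.
have key a b : a * sqnorm z = b -> a / weight w = b / weight z.
  by move=> <-; rewrite -hw; field; rewrite !gt_eqF.
by elim/ord3P: i => /=; apply: key; rewrite ?mulrBl ?mul1r ?h1 ?h3; ring.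
Qed.

Lemma klein_iter_rotation k p i : klein (iter k (@rotation R) p) i = klein p (i + k%:R).
Proof.
elim: k i => [|k IH] i; first by rewrite addr0.
by rewrite iterS klein_rotation IH -natr1; congr klein; ring.
Qed.

Lemma natr_ord3 (k : 'I_3) : (k : nat)%:R = k :> 'I_3.
Proof. by case: k => [[|[|[|//]]] hk]; apply/val_inj. Qed.

Lemma klein_side0 p : @side0 R p -> klein p (- 1) = 0.
Proof.
by case=> [->|[t t0 ->]] /=; rewrite ?mul0r.
Qed.

Lemma klein_half_turn p i : @side0 R p -> klein (half_turn p) i = klein p (1 - i).
Proof.
case=> [->|[t t0 ->]].
  by elim/ord3P: i => /=; rewrite /weight /sqnorm /= ?expr0n /=; field.
have [->|tn0] := eqVneq t 0.
  by rewrite /half_turn eqxx; elim/ord3P: i => /=; rewrite /weight /sqnorm /= ?expr0n /=; field.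
rewrite /half_turn ifF; last by rewrite eq_complex /= (negbTE tn0) andbF.
have tp : 0 < t by rewrite lt_neqAle eq_sym tn0.
by elim/ord3P: i => /=; rewrite /weight /sqnorm /=; field; nra.
Qed.

Definition closed_half_plane : set sphere :=
  [set p | if p is Some z then 0 <= complex.Im z else True].

(** The coordinates see Im z only through its square, so injectivity is confined to the closed
    half-plane. *)
Lemma klein_inj p q : closed_half_plane p -> closed_half_plane q ->
  klein p =1 klein q -> p = q.
Proof.
have none z : klein (Some z) <> klein None.
  move=> h; have := congr1 (fun f => f 1) h; have := congr1 (fun f => f (1 + 1)) h.
  have wz := weight_gt0 z; rewrite /= => /eqP; rewrite mulf_eq0 invr_eq0 (gt_eqF wz) orbF => /eqP h1.
  by move/eqP; rewrite mulf_eq0 invr_eq0 (gt_eqF wz) orbF h1 subr0 oner_eq0.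
case: p q => [z|] [w|] //= z0 w0 /funext h; last 2 first.
- by have := none z h.
- by have := none w (esym h).
have wz := weight_gt0 z; have ww := weight_gt0 w.
have h0 : (sqnorm z - complex.Re z) / weight z = (sqnorm w - complex.Re w) / weight w.
  exact: (congr1 (fun f => f ord0) h).
have h1 : (1 - complex.Re z) / weight z = (1 - complex.Re w) / weight w.
  exact: (congr1 (fun f => f 1) h).
have h2 : complex.Re z / weight z = complex.Re w / weight w.
  exact: (congr1 (fun f => f (1 + 1)) h).
have e12 : (weight z)^-1 = (weight w)^-1.
  have := congr2 +%R h1 h2; rewrite -!mulrDl !subrK; by rewrite !mul1r.
have iw : (weight w)^-1 != 0 by rewrite invr_eq0 gt_eqF.
have re : complex.Re z = complex.Re w by apply: (mulIf iw); rewrite -h2 e12.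
have n : sqnorm z = sqnorm w.
  have : sqnorm z - complex.Re z = sqnorm w - complex.Re w by apply: (mulIf iw); rewrite -h0 e12.
  by rewrite re => /addIr.
have im : complex.Im z = complex.Im w.
  by apply/eqP; rewrite -(eqrXn2 (n := 2)) //; apply/eqP; move: n; rewrite /sqnorm re => /addrI.
by case: z w re im {z0 w0 h h0 h1 h2 e12 iw n wz ww} => [a b] [c d] /= -> ->.
Qed.

Lemma half_plane_rotation p : closed_half_plane p -> closed_half_plane (rotation p).
Proof.
case: p => [z|_]; last exact: lexx.
have [->|z0] := eqVneq z 0; first by rewrite /rotation eqxx.
have [w [-> [_ h2 _ n0]]] := rotationE z0.
by rewrite /closed_half_plane /= -h2 pmulr_lge0.
Qed.

Lemma half_plane_iter_rotation k p :
  closed_half_plane p -> closed_half_plane (iter k (@rotation R) p).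
Proof. by move=> hp; elim: k => //= k; exact: half_plane_rotation. Qed.

Lemma half_plane_side0 p : @side0 R p -> closed_half_plane p /\ closed_half_plane (half_turn p).
Proof.
case=> [->|[t t0 ->]]; first by split=> //=.
split=> //=; rewrite /half_turn; case: ifP => // _.
by rewrite /closed_half_plane /= expr0n /= add0r opprK divr_ge0 // sqr_ge0.
Qed.

Local Notation triangle := (@ideal_triangle R `|` @ideal_vertices R).

Lemma triangleP (p : sphere) :
  triangle p <-> closed_half_plane p /\ forall i, 0 <= klein p i.
Proof.
case: p => [z|]; last first.
  by split=> [_|_]; [split=> // i; exact: ler0n|right; right; right].
have wz := weight_gt0 z.
have dist : (2^-1 <= `|z - 2^-1|) = (0 <= sqnorm z - complex.Re z).
  case: z wz => a b _; rewrite normc_def.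
  have -> : (2^-1 : R[i]) = (2^-1 : R)%:C by rewrite fmorphV rmorph_nat.
  rewrite lecE /= eqxx /= subr0 /sqnorm /=.
  set N := (X in Num.sqrt X); have N0 : 0 <= N by rewrite addr_ge0 ?sqr_ge0.
  have := sqr_sqrtr N0; have := sqrtr_ge0 N; set r := Num.sqrt N => r0 rN.
  have NE : N = a ^+ 2 + b ^+ 2 - a + 2^-1 ^+ 2 by rewrite /N; field.
  by apply/idP/idP => ?; nra.
split=> [[[w [/andP[x0 x1] y0 d] [zw]]|h]|].
- subst w; rewrite dist in d; split; first exact: ltW.
  by elim/ord3P => /=; rewrite divr_ge0 ?(ltW wz) //; lra.
- have [->|->] : z = 0 \/ z = 1 by case: h => [[->]|[[->]|]]; [left|right|].
    split; first exact: lexx.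
    by elim/ord3P => /=; rewrite divr_ge0 ?(ltW (weight_gt0 _)) // /sqnorm /= ?expr0n /=; lra.
  split; first exact: lexx.
  by elim/ord3P => /=; rewrite divr_ge0 ?(ltW (weight_gt0 _)) // /sqnorm /= ?expr0n /=; lra.
- move=> [/= y0 kp].
  have k0 := kp ord0; have k1 := kp 1; have k2 := kp (1 + 1).
  rewrite /= pmulr_lge0 ?invr_gt0 // in k0; rewrite /= pmulr_lge0 ?invr_gt0 // in k1.
  rewrite /= pmulr_lge0 ?invr_gt0 // in k2.
  have [y0'|] := ltrP 0 (complex.Im z).
    left; exists z => //; split=> //; last by rewrite dist.
    by rewrite k2 -subr_ge0 k1.
  move=> y1; have im : complex.Im z = 0 by apply/le_anti; rewrite y0 y1.
  right; case: z {wz dist kp y0 y1} im k0 k1 k2 => [a b] /= ->; rewrite /sqnorm /= expr0n /= => k0 k1 k2.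
  (* On the real axis the first coordinate requires a^2 - a >= 0 while the other two require 0 <= a
     <= 1, so only the ideal vertices 0 and 1 remain. *)
  have : a * (1 - a) = 0 by nra.
  move/eqP; rewrite mulf_eq0 => /orP[/eqP ->|]; first by left.
  by rewrite subr_eq0 => /eqP <-; right; left.
Qed.

(** For coordinates (a, b, c) the last two give weight 1 / (b + c), hence Re z = c / (b + c) and
    |z|^2 = (a + c) / (b + c); then (Im z)^2 = (ab + bc + ca) / (b + c)^2. The case b + c = 0 is the
    vertex oo. *)
Definition klein_inv (x : Δ2) : sphere :=
  let s := bcoord x 1 + bcoord x (1 + 1) in
  if s == 0 then None else Some ((bcoord x (1 + 1) / s) +i*
    (Num.sqrt (bcoord x ord0 * bcoord x 1 + bcoord x 1 * bcoord x (1 + 1)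
       + bcoord x (1 + 1) * bcoord x ord0) / s)).

Lemma sum3 (f : 'I_3 -> R) : \sum_i f i = f ord0 + f 1 + f (1 + 1).
Proof.
rewrite !big_ord_recl big_ord0 addr0 addrA.
by congr (_ + f _ + f _); apply/val_inj.
Qed.

Lemma klein_klein_inv x i : klein (klein_inv x) i = bcoord x i.
Proof.
have := sum_bcoord x; rewrite sum3.
have a0 := bcoord_ge0 x ord0; have b0 := bcoord_ge0 x 1; have c0 := bcoord_ge0 x (1 + 1).
rewrite /klein_inv.
set a := bcoord x ord0 in a0 *; set b := bcoord x 1 in b0 *.
set c := bcoord x (1 + 1) in c0 * => abc.
have [s0|sn0] := eqVneq (b + c) 0.
  have b1 : b = 0 by lra.
  have c1 : c = 0 by lra.
  by elim/ord3P: i => /=; rewrite -?/a -?/b -?/c ?b1 ?c1 //; lra.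
have q0 : 0 <= a * b + b * c + c * a by nra.
set q := Num.sqrt _.
have qq : q ^+ 2 = a * b + b * c + c * a by rewrite sqr_sqrtr.
have nz : sqnorm (c / (b + c) +i* (q / (b + c))) = (a + c) / (b + c).
  rewrite /sqnorm /= !expr_div_n qq; field; exact: sn0.
have aE : a = 1 - b - c by lra.
have wz : weight (c / (b + c) +i* (q / (b + c))) = (b + c)^-1.
  by rewrite /weight nz /= aE; field; exact: sn0.
rewrite /klein wz invrK nz /=.
by elim/ord3P: i => /=; rewrite -?/a -?/b -?/c; field; exact: sn0.
Qed.

Lemma half_plane_klein_inv x : closed_half_plane (klein_inv x).
Proof.
rewrite /klein_inv; case: ifP => // _; rewrite /closed_half_plane /=.
by rewrite divr_ge0 ?sqrtr_ge0 // addr_ge0 // bcoord_ge0.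
Qed.

Lemma triangle_klein_inv x : klein_inv x \in triangle.
Proof.
apply/mem_set/triangleP; split; first exact: half_plane_klein_inv.
by move=> i; rewrite klein_klein_inv bcoord_ge0.
Qed.

Definition from_simplex (x : Δ2) : triangle := SigSub (triangle_klein_inv x).

Lemma triangle_klein_ge0 (p : triangle) i : 0 <= klein (set_val p) i.
Proof. by have /triangleP[_] := set_valP p. Qed.

Definition to_simplex (p : triangle) : Δ2 :=
  mk_simplex (triangle_klein_ge0 p) (sum_klein _).

Lemma bcoord_to_simplex p i : bcoord (to_simplex p) i = klein (set_val p) i.
Proof. exact: bcoord_mk. Qed.

Lemma from_simplexK : cancel from_simplex to_simplex.
Proof. by move=> x; apply: bcoord_inj => i; rewrite bcoord_to_simplex klein_klein_inv. Qed.

Lemma to_simplexK : cancel to_simplex from_simplex.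
Proof.
move=> p; apply: val_inj; apply: klein_inj.
- exact: half_plane_klein_inv.
- by have /triangleP[] := set_valP p.
- by move=> i; rewrite klein_klein_inv bcoord_to_simplex.
Qed.

Lemma nbhs_complex (z : R[i]^o) (A : set R[i]^o) : nbhs z A <->
  exists2 e : R, 0 < e & forall w : R[i], `|complex.Re z - complex.Re w| < e ->
    `|complex.Im z - complex.Im w| < e -> A w.
Proof.
split=> [/nbhs_ballP[[r s]] /=|[e e0 eA]].
  (* The radius of a ball is itself a complex number; its positivity forces the imaginary part to
     vanish. *)
  rewrite ltcE /= => /andP[/eqP -> r0] rA.
  exists (r / 2); first by rewrite divr_gt0.
  move=> w h1 h2; apply: rA; rewrite /ball /= normc_def ltcR.
  case: z w h1 h2 => a b [c d] /= h1 h2.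
  rewrite -(ger0_norm (ltW r0)) -sqrtr_sqr ltr_sqrt ?exprn_gt0 //.
  move: h1 h2; rewrite !ltr_norml => /andP[? ?] /andP[? ?]; nra.
apply/nbhs_ballP; exists (e%:C); first by rewrite /= ltcR.
move=> w; rewrite /ball /= normc_def ltcR => h.
have h' : Num.sqrt ((complex.Re z - complex.Re w) ^+ 2 + (complex.Im z - complex.Im w) ^+ 2) < e.
  by case: z w h {eA} => a b [c d].
by apply: eA; apply: le_lt_trans h'; rewrite -sqrtr_sqr ler_wsqrtr // ?lerDl ?lerDr sqr_ge0.
Qed.

Lemma Re_continuous : continuous (fun z : R[i]^o => complex.Re z : R).
Proof.
move=> z A /nbhs_ballP[e e0 eA]; apply/nbhs_complex; exists e => // w h _; exact: eA.
Qed.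

Lemma Im_continuous : continuous (fun z : R[i]^o => complex.Im z : R).
Proof.
move=> z A /nbhs_ballP[e e0 eA]; apply/nbhs_complex; exists e => // w _ h; exact: eA.
Qed.

Lemma complex_continuous (T : topologicalType) (f g : T -> R) :
  continuous f -> continuous g -> continuous (fun t => f t +i* g t : R[i]^o).
Proof.
move=> fc gc t A /nbhs_complex[e e0 eA].
have h1 := fc t _ (nbhsx_ballx _ _ e0); have h2 := gc t _ (nbhsx_ballx _ _ e0).
apply: (@filterS2 _ _ (nbhs_filter t) _ _ _ _ h1 h2) => y h h'; apply: eA; [exact: h|exact: h'].
Qed.

Lemma complex_compact_nbhs (z : R[i]^o) : exists N : set R[i]^o, [/\ compact N, closed N & nbhs z N].
Proof.
pose f (p : R * R) : R[i]^o := p.1 +i* p.2.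
have fc : continuous f.
  by apply: complex_continuous => p; [exact: cvg_fst|exact: cvg_snd].
pose B := `[complex.Re z - 1, complex.Re z + 1]%classic `*` `[complex.Im z - 1, complex.Im z + 1]%classic.
have cN : compact (f @` B).
  apply: continuous_compact; first exact: continuous_subspaceT.
  by apply: compact_setX; exact: segment_compact.
exists (f @` B); split=> //; first exact: (compact_closed (@norm_hausdorff _ _) cN).
apply/nbhs_complex; exists 1 => // w h1 h2; exists (complex.Re w, complex.Im w); last by case: w {h1 h2}.
move: h1 h2; rewrite !ltr_norml => /andP[? ?] /andP[? ?].
by split; rewrite /= in_itv /=; apply/andP; split; lra.
Qed.

Lemma sphere_hausdorff : hausdorff_space sphere.
Proof.
have none (z : R[i]^o) : exists A B : set sphere, [/\ nbhs (Some z : sphere) A,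
    nbhs (None : sphere) B & A `&` B = set0].
  have [N [cN clN zN]] := complex_compact_nbhs z.
  exists (Some @` N), (Some @` (~` N) `|` [set None]); split.
  - exact: (@one_point_compactification_some_nbhs R[i]^o z N zN).
  - by exists N.
  - by apply/seteqP; split=> // p [[w Nw <-] [[w' Nw' [ww']]|]] //; apply: Nw'; rewrite ww'.
move=> [z|] [w|] // pq.
- congr Some; apply: (@norm_hausdorff _ R[i]^o) => A B zA wB.
  have [_ [[a Aa <-] [b Bb [ab]]]] := pq _ _ (@one_point_compactification_some_nbhs R[i]^o _ _ zA)
    (@one_point_compactification_some_nbhs R[i]^o _ _ wB).
  by exists a; split=> //; rewrite -ab.
- have [A [B [zA nB AB]]] := none z; have [p] := pq _ _ zA nB.
  by rewrite AB.
- have [A [B [zA nB AB]]] := none w; have [p] := pq _ _ nB zA.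
  by rewrite setIC AB.
Qed.

Lemma klein_inv_continuous : continuous klein_inv.
Proof.
pose s (x : Δ2) := bcoord x 1 + bcoord x (1 + 1).
have cc i : continuous (fun x : Δ2 => bcoord x i) by exact: bcoord_continuous_simplex.
have sc : continuous s by exact: continuous_add.
move=> x; have [s0|sn0] := eqVneq (s x) 0.
  rewrite /continuous_at {2}/klein_inv -/(s x) s0 eqxx => B [K [cK _] KB].
  (* Continuity at oo: a compact K satisfies |z|^2 <= M, while |z|^2 = (a + c) / (b + c) exceeds M
     as soon as a + c - M (b + c) > 0, an open condition that holds at the corner. *)
  have [M MK] : exists M : R, forall z, K z -> sqnorm z <= M.
    have nc : continuous (sqnorm : R[i]^o -> R).
      rewrite (_ : sqnorm = fun z => complex.Re z * complex.Re z + complex.Im z * complex.Im z) //.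
      by apply: continuous_add; apply: continuous_mul;
        [exact: Re_continuous|exact: Re_continuous|exact: Im_continuous|exact: Im_continuous].
    have /compact_bounded[M [_ MK]] : compact (sqnorm @` K).
      by apply: continuous_compact cK; exact: continuous_subspaceT.
    exists (M + 1) => z Kz; apply: le_trans (ler_norm _) (MK _ _ _ _); first by rewrite ltrDl.
    by exists z.
  have hc : continuous (fun y : Δ2 => bcoord y ord0 + bcoord y (1 + 1) + (- M) * s y).
    by apply: continuous_add; [exact: continuous_add|apply: continuous_mul => // ?; exact: cst_continuous].
  have n1 : \forall y \near x, 0 < bcoord y ord0 + bcoord y (1 + 1) + (- M) * s y.
    apply: (hc x [set r | 0 < r]); apply: lt_nbhsr.
    have := sum_bcoord x; rewrite sum3 s0; move: s0; rewrite /s.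
    by have := bcoord_ge0 x 1; have := bcoord_ge0 x (1 + 1); lra.
  apply: filterS n1 => y y0; apply: KB.
  rewrite /klein_inv -/(s y); case: eqVneq => sy; first by right.
  left; eexists; last by [].
  move=> /MK; apply/negP; rewrite -ltNge.
  have a0 := bcoord_ge0 y ord0; have b0 := bcoord_ge0 y 1; have c0 := bcoord_ge0 y (1 + 1).
  have sp : 0 < s y by rewrite lt_neqAle eq_sym sy addr_ge0.
  rewrite /sqnorm /= !expr_div_n sqr_sqrtr; last by rewrite !addr_ge0 // mulr_ge0.
  rewrite -mulrDl ltr_pdivlMr ?exprn_gt0 //.
  move: y0 sp; rewrite /s; set a := bcoord y ord0; set b := bcoord y 1; set c := bcoord y _.
  by move=> y0 sp; nra.
pose f (y : Δ2) : R[i]^o := (bcoord y (1 + 1) / s y) +i*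
    (Num.sqrt (bcoord y ord0 * bcoord y 1 + bcoord y 1 * bcoord y (1 + 1)
       + bcoord y (1 + 1) * bcoord y ord0) / s y).
have near_s : \forall y \near x, s y != 0.
  by apply: (sc x [set r | r != 0]); apply: open_nbhs_nbhs; split => //; exact: open_neq.
have fx : f y @[y --> x] --> f x.
  have qc : continuous (fun y : Δ2 => Num.sqrt (bcoord y ord0 * bcoord y 1 + bcoord y 1 * bcoord y (1 + 1)
       + bcoord y (1 + 1) * bcoord y ord0)).
    have pc : continuous (fun y : Δ2 => bcoord y ord0 * bcoord y 1 + bcoord y 1 * bcoord y (1 + 1)
       + bcoord y (1 + 1) * bcoord y ord0).
      by apply: continuous_add; [apply: continuous_add|]; exact: continuous_mul.
    by move=> y; apply: continuous_comp; [exact: pc|exact: sqrt_continuous].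
  move=> A /nbhs_complex[e e0 eA].
  have h1 : bcoord y (1 + 1) / s y @[y --> x] --> bcoord x (1 + 1) / s x.
    exact: continuous_div.
  have h2 := continuous_div qc sc sn0.
  have g1 := h1 _ (nbhsx_ballx _ _ e0); have g2 := h2 _ (nbhsx_ballx _ _ e0).
  apply: (@filterS2 _ _ (nbhs_filter x) _ _ _ _ g1 g2) => y h h'; apply: eA; [exact: h|exact: h'].
move=> B; rewrite {1}/klein_inv -/(s x) (negbTE sn0) => /fx nB.
apply: filterS2 near_s nB => y sy; rewrite /f /=.
by rewrite /klein_inv -/(s y) (negbTE sy).
Qed.

Lemma from_simplex_continuous : continuous from_simplex.
Proof. by apply: continuous_comp_initial => x; exact: klein_inv_continuous. Qed.

Lemma triangle_hausdorff : hausdorff_space triangle.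
Proof.
move=> p q pq; apply: val_inj; apply: sphere_hausdorff => A B pA qB.
have [r [Ar Br]] := pq _ _ (@initial_continuous _ _ set_val p _ pA) (@initial_continuous _ _ set_val q _ qB).
by exists (set_val r).
Qed.

(** A continuous bijection from a compact space to a Hausdorff space is closed, so no estimate of
    [klein] near the ideal vertices is needed. *)
Lemma from_simplex_open (W : set triangle) : open (from_simplex @^-1` W) -> open W.
Proof.
move=> oW; rewrite -[W]setCK; apply: closed_openC.
have -> : ~` W = from_simplex @` (~` (from_simplex @^-1` W)).
  apply/seteqP; split=> [p Wp|_ [x Wx <-] //].
  by exists (to_simplex p); rewrite /= to_simplexK.
apply: (compact_closed triangle_hausdorff); apply: continuous_compact.
  by apply: continuous_subspaceT; exact: from_simplex_continuous.
apply: (subclosed_compact _ (@compact_simplex R 2)) => //.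
exact: open_closedC.
Qed.

End KleinModel.

(** * The surface of an oriented cubic graph *)

Section Pairings.
Context {T : finType}.
Implicit Types (F : {set {set T}}) (h : T).

Definition pairing F := finset.partition F finset.setT && [forall e in F, #|e| == 2%N].

Definition partner F h : T := odflt h [pick h' | [set h; h']%SET \in F].

Lemma pairing_pblock F h : pairing F -> [/\ h \in finset.pblock F h, finset.pblock F h \in F & #|finset.pblock F h| = 2%N].
Proof.
case/andP=> /and3P[/eqP cF tF _] /forall_inP F2.
have hc : h \in finset.cover F by rewrite cF inE.
split; first by rewrite mem_pblock.
  exact: pblock_mem.
by apply/eqP/F2/pblock_mem.
Qed.

Lemma pairing_pblockE F h e : pairing F -> e \in F -> h \in e -> finset.pblock F h = e.
Proof. by case/andP=> /and3P[_ tF _] _; exact: def_pblock. Qed.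

Lemma pairing_neq F h h' : pairing F -> [set h; h']%SET \in F -> h != h'.
Proof.
case/andP=> _ /forall_inP F2 /F2.
by rewrite cards2; case: (h =P h').
Qed.

Lemma partner_unique F h h1 h2 : pairing F ->
  [set h; h1]%SET \in F -> [set h; h2]%SET \in F -> h1 = h2.
Proof.
move=> pF F1 F2.
have := pairing_pblockE pF F1 (finset.set21 h h1).
rewrite (pairing_pblockE pF F2 (finset.set21 h h2)) => /setP/(_ h2).
rewrite !inE eqxx orbT; case: eqP => [h2h|_ /esym/eqP -> //].
by have := pairing_neq pF F2; rewrite h2h eqxx.
Qed.

Lemma partnerE F h : pairing F -> [set h; partner F h]%SET \in F.
Proof.
move=> pF; rewrite /partner; case: pickP => //= no.
have [hb bF /eqP/cards2P[a [b [ab E]]]] := pairing_pblock h pF.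
rewrite E in hb bF; move: hb; rewrite !inE => /orP[]/eqP hE; subst h.
  by have := no b; rewrite bF.
by have := no a; rewrite finset.setUC bF.
Qed.

Lemma partnerP F h h' : pairing F -> ([set h; h']%SET \in F) = (h' == partner F h).
Proof.
move=> pF; apply/idP/eqP => [|->]; last exact: partnerE.
by move=> hF; exact: partner_unique hF (partnerE h pF).
Qed.

Lemma partner_neq F h : pairing F -> partner F h != h.
Proof. by move=> pF; rewrite eq_sym; apply: pairing_neq (partnerE h pF). Qed.

Lemma partnerK F : pairing F -> involutive (partner F).
Proof. by move=> pF h; apply/esym/eqP; rewrite -partnerP // finset.setUC; exact: partnerE. Qed.

Lemma pblock_partner F h : pairing F -> finset.pblock F h = [set h; partner F h]%SET.
Proof. by move=> pF; apply: pairing_pblockE (partnerE h pF) _; rewrite ?finset.set21. Qed.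

Lemma card_pairing F : pairing F -> (2 * #|F|)%N = #|T|.
Proof.
case/andP=> pF /forall_inP F2; rewrite -cardsT (card_partition pF).
rewrite (eq_bigr (fun=> 2%N)); last by move=> e /F2/eqP.
by rewrite sum_nat_const mulnC.
Qed.

End Pairings.

Lemma configurationP n (F : {set {set half_edge n}}) : F \in configurations n = pairing F.
Proof. by rewrite inE. Qed.

Section CyclicOrderings.

Lemma ord3_mem (a b c d : 'I_3) : a != b -> a != c -> b != c -> [\/ d = a, d = b | d = c].
Proof.
by elim/ord3P: a; elim/ord3P: b; elim/ord3P: c; elim/ord3P: d => //;
  do ?[by move=> *; apply: Or31; apply/val_inj | by move=> *; apply: Or32; apply/val_inj
  | by move=> *; apply: Or33; apply/val_inj].
Qed.

(** A permutation of three points with a fixed point has square 1, which order 3 excludes. *)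
Lemma order3_neq (s : {perm 'I_3}) i : #[s]%g = 3%N -> s i != i.
Proof.
move=> s3; apply/eqP => si.
suff s2 : (s ^+ 2 = 1)%g.
  have := expg_order s; rewrite s3 expgS s2 mulg1 => s1.
  by move: s3; rewrite s1 order1.
apply/permP => j; rewrite permX perm1 /=.
have [->|ji] := eqVneq j i; first by rewrite !si.
have sji : s j != i by rewrite -{1}si (inj_eq perm_inj).
have [sjE|sjj] := eqVneq (s j) j; first by rewrite !sjE.
have ij : i != s j by rewrite eq_sym.
have ij' : i != j by rewrite eq_sym.
have [] := ord3_mem (s (s j)) ij' ij (_ : j != s j); rewrite ?(eq_sym j) //.
  by rewrite -{1}si => /perm_inj /eqP; rewrite (negbTE sji).
by move=> /perm_inj/eqP; rewrite (negbTE sjj).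
Qed.

Lemma order3_orbit_inj (s : {perm 'I_3}) : #[s]%g = 3%N ->
  injective (fun k : 'I_3 => (s ^+ k)%g ord0).
Proof.
move=> s3 k l.
have s0 := order3_neq ord0 s3; have s1 := order3_neq (s ord0) s3.
have s2 : s (s ord0) != ord0.
  apply: contra s0 => /eqP s2; have /permP/(_ ord0) := expg_order s.
  by rewrite s3 permX perm1 /= s2 => ->.
elim/ord3P: k; elim/ord3P: l => //=; rewrite ?expg0 ?expg1 ?perm1 ?permX /= => /eqP;
  by rewrite ?(negbTE s0) ?(negbTE s1) ?(negbTE s2) // eq_sym ?(negbTE s0) ?(negbTE s1) ?(negbTE s2).
Qed.

End CyclicOrderings.

Section Sides.
Variables (n : nat) (O : orientation n).

Definition side_half_edge (s : 'I_n * 'I_3) : half_edge n := ordered_half_edge O s.1 s.2.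

Lemma side_half_edge_inj : injective side_half_edge.
Proof.
move=> [v k] [w l] [vw]; subst w => kl; congr (_, _).
by apply: (order3_orbit_inj (s := val (O v))) kl; apply/eqP; exact: (valP (O v)).
Qed.

Variable F : {set {set half_edge n}}.
Hypothesis pF : pairing F.

(** The partner map transported from half-edges to sides, which are numbered in the cyclic order at
    their vertex. The configuration determines partners alone; the numbering brings in the
    orientation. *)
Definition side_mate (s : 'I_n * 'I_3) := invF side_half_edge_inj (partner F (side_half_edge s)).

Lemma side_mateE s : side_half_edge (side_mate s) = partner F (side_half_edge s).
Proof. exact: f_invF. Qed.

Lemma side_mateK : involutive side_mate.
Proof. by move=> s; apply: side_half_edge_inj; rewrite !side_mateE partnerK. Qed.

Lemma side_mate_neq s : side_mate s != s.
Proof. by rewrite -(inj_eq side_half_edge_inj) side_mateE partner_neq. Qed.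

Lemma side_mateP s t :
  ([set side_half_edge s; side_half_edge t]%SET \in F) = (side_mate s == t).
Proof. by rewrite partnerP // -[RHS](inj_eq side_half_edge_inj) side_mateE eq_sym. Qed.

Lemma side_pblockP s t :
  (finset.pblock F (side_half_edge t) == finset.pblock F (side_half_edge s)) =
  (t == s) || (t == side_mate s).
Proof.
rewrite !pblock_partner //; apply/eqP/idP => [/setP/(_ (side_half_edge t))|].
  by rewrite !inE eqxx -!side_mateE !(inj_eq side_half_edge_inj) => /esym.
case/orP=> /eqP -> //; rewrite side_mateE partnerK //; exact: finset.setUC.
Qed.

Definition turn_fun (h : half_edge n) : half_edge n :=
  (h.1, ((val (O h.1))^-1)%g h.2).

Lemma turn_inj : injective turn_fun.
Proof. by move=> [v i] [w j] [vw]; subst w => /perm_inj ->. Qed.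

Definition turn : {perm half_edge n} := perm turn_inj.

Lemma partner_inj : injective (partner F).
Proof. exact: can_inj (partnerK pF). Qed.

(* Crossing the edge and then turning at the vertex goes around a cusp. *)
Definition cusp_perm : {perm half_edge n} := (perm partner_inj * turn)%g.

Lemma cusp_permE h : cusp_perm h = turn_fun (partner F h).
Proof. by rewrite permM !permE. Qed.

Lemma side_half_edge_next s : side_half_edge (next_side side_mate s) = cusp_perm (side_half_edge s).
Proof.
rewrite cusp_permE -side_mateE /next_side /side_half_edge /ordered_half_edge /turn_fun.
case: (side_mate s) => v k /=; congr (_, _).
have s3 : #[val (O v)]%g = 3%N by apply/eqP; exact: (valP (O v)).
(* Writing k as l + 1 modulo 3 turns one backward turn into a cancellation; at the wrap-around the
   power 3 of the cyclic ordering is 1. *)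
have -> : (k : nat) = (k - 1 + 1 : 'I_3) by rewrite subrK.
set l := k - 1; apply: (canRL (permK _)); rewrite -permM -expgSr.
have e3 : (val (O v) ^+ 3 = 1)%g by rewrite -[X in (_ ^+ X)%g]s3 expg_order.
by elim/ord3P: l => //=; rewrite e3 expg0.
Qed.

Lemma iter_next_side m s :
  side_half_edge (iter m (next_side side_mate) s) = iter m cusp_perm (side_half_edge s).
Proof. by elim: m => //= m IH; rewrite side_half_edge_next IH. Qed.

Lemma side_porbitP s t :
  porbit cusp_perm (side_half_edge s) = porbit cusp_perm (side_half_edge t) ->
  exists m, t = iter m (next_side side_mate) s.
Proof.
move=> st; have : side_half_edge t \in porbit cusp_perm (side_half_edge s).
  by rewrite st porbit_id.
case/porbitP => m; rewrite permX => tE; exists m.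
by apply: side_half_edge_inj; rewrite iter_next_side.
Qed.

End Sides.

Section Surface.
Context {R : realType} {n : nat}.
Variables (F : {set {set half_edge n}}) (O : orientation n).
Hypothesis pF : pairing F.
Local Notation Δ2 := (simplex R 2).
Local Notation triangle := (@ideal_triangle R `|` @ideal_vertices R).
Local Notation X := (compact_surface R F O).
Local Notation mate := (side_mate O F).

Definition chart (v : 'I_n) (x : Δ2) : X :=
  (\pi_(glued_surface F O triangle) (existT (fun=> set_type triangle) v (from_simplex x)))%qT.

Lemma chart_continuous v : continuous (chart v).
Proof.
move=> x; apply: (@continuous_comp _ _ _ (fun x => existT (fun=> set_type triangle) v (from_simplex x))).
  apply: (@continuous_comp _ _ _ from_simplex); first exact: from_simplex_continuous.
  exact: existT_continuous.
exact: pi_continuous.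
Qed.

Lemma chart_open (V : set X) : (forall v, open (chart v @^-1` V)) -> open V.
Proof.
move=> oV; apply/sigT_openP => v; apply: from_simplex_open; exact: oV.
Qed.

Lemma chart_surj (p : X) : exists v x, chart v x = p.
Proof.
by elim/quotW: p => -[v q]; exists v, (to_simplex q); rewrite /chart to_simplexK.
Qed.

Lemma glued_side_glued (a b : copies n triangle) : glued F O a b ->
  side_glued mate (projT1 a, to_simplex (projT2 a)) (projT1 b, to_simplex (projT2 b)).
Proof.
move=> [k [l [p p0 [abF aE bE]]]]; exists k, l => /=.
have aK i : bcoord (to_simplex (projT2 a)) i = klein p (i + k).
  by rewrite bcoord_to_simplex aE klein_iter_rotation natr_ord3.
have bK i : bcoord (to_simplex (projT2 b)) i = klein p (1 - (i + l)).
  by rewrite bcoord_to_simplex bE klein_iter_rotation natr_ord3 klein_half_turn.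
split.
- by apply/eqP; rewrite -(side_mateP O pF).
- by rewrite aK subrK klein_side0.
- by move=> i; rewrite aK bK /flip; congr klein; ring.
Qed.

Lemma side_glued_glued v x w y : side_glued mate (v, x) (w, y) ->
  glued F O (existT (fun=> set_type triangle) v (from_simplex x))
    (existT (fun=> set_type triangle) w (from_simplex y)).
Proof.
move=> [k [l /= [mk x0 xy]]].
(* Shifting the coordinates of x by k undoes k rotations and brings the point to the side from 0 to
   oo. *)
pose f i := bcoord x (i - k).
have f0 i : 0 <= f i by exact: bcoord_ge0.
have f1 : \sum_i f i = 1.
  by rewrite -(sum_bcoord x) [RHS](reindex_inj (addIr (- k))).
pose p := klein_inv (mk_simplex f0 f1).
have pK i : klein p i = bcoord x (i - k) by rewrite klein_klein_inv bcoord_mk.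
have p0 : side0 p.
  rewrite /p /klein_inv; case: ifP => [_|_]; first by left.
  right; rewrite !bcoord_mk /f.
  have -> : bcoord x (1 + 1 - k) = 0.
    by rewrite -x0; congr bcoord; congr (_ - _); apply/val_inj.
  exists (Num.sqrt (bcoord x (ord0 - k) * bcoord x (1 - k)) / bcoord x (1 - k)).
    by rewrite divr_ge0 ?sqrtr_ge0 ?bcoord_ge0.
  by rewrite mul0r !mulr0 !addr0 mul0r addr0.
have [hp hp'] := half_plane_side0 p0.
exists k, l, p => //; split => /=.
- by rewrite (side_mateP O pF (v, k) (w, l)) mk.
- apply: klein_inj.
  + exact: half_plane_klein_inv.
  + exact: half_plane_iter_rotation.
  + by move=> i; rewrite klein_klein_inv klein_iter_rotation natr_ord3 pK addrK.
- apply: klein_inj.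
  + exact: half_plane_klein_inv.
  + exact: half_plane_iter_rotation.
  + move=> i; rewrite klein_klein_inv klein_iter_rotation natr_ord3 klein_half_turn //.
    by rewrite pK xy /flip; congr bcoord; ring.
Qed.

Lemma chart_glued p q : side_glued mate p q -> chart p.1 p.2 = chart q.1 q.2.
Proof.
case: p q => [v x] [w y] /side_glued_glued vw; apply/eqmodP/asboolP.
exact: rst_step.
Qed.

Lemma chart_eq p q : chart p.1 p.2 = chart q.1 q.2 ->
  clos_refl_sym_trans _ (side_glued mate) p q.
Proof.
case: p q => [v x] [w y] /= /eqmodP/asboolP vw.
rewrite -[x]from_simplexK -[y]from_simplexK.
have : forall a b, clos_refl_sym_trans _ (glued F O (P := triangle)) a b ->
  clos_refl_sym_trans _ (side_glued mate)
    (projT1 a, to_simplex (projT2 a)) (projT1 b, to_simplex (projT2 b)).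
  move=> a b; elim=> [{}a {}b ab|{}a|{}a {}b _|{}a {}b c _ ab _].
  - exact/rst_step/glued_side_glued.
  - exact: rst_refl.
  - exact: rst_sym.
  - exact: rst_trans ab.
by move=> /(_ _ _ vw).
Qed.

Lemma compact_surface_genus_le : total_genus R X <= 32 * n%:R.
Proof.
exact: (glued_genus_le (side_mateK O pF) chart_continuous chart_open chart_surj chart_glued chart_eq).
Qed.

Lemma compact_surface_genus_ge :
  (n%:R / 2 - #|porbits (cusp_perm O pF)|%:R) / 2 <= total_genus R X.
Proof.
pose E : finType := {e | e \in F}.
pose Q : finType := {c | c \in porbits (cusp_perm O pF)}.
have eF s : finset.pblock F (side_half_edge O s) \in F by have [] := pairing_pblock (side_half_edge O s) pF.
have cQ s : porbit (cusp_perm O pF) (side_half_edge O s) \in porbits (cusp_perm O pF).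
  exact: imset_f.
pose edge s : E := exist (fun e => e \in F) _ (eF s).
pose cusp s : Q := exist (fun c => c \in porbits (cusp_perm O pF)) _ (cQ s).
have edgeP s t : (edge t == edge s) = (t == s) || (t == mate s).
  by rewrite -(side_pblockP O pF).
have cuspP s t : cusp s = cusp t -> exists m, t = iter m (next_side mate) s.
  by move=> /(congr1 val); exact: side_porbitP.
have := glued_genus_euler (side_mateK O pF) chart_continuous chart_open chart_surj
  chart_glued chart_eq (side_mate_neq O pF) edgeP cuspP.
rewrite !card_sig; apply: le_trans; rewrite ler_pM2r ?invr_gt0 //.
(* There are 3n/2 edges, so 3n - 3n/2 - n leaves n/2. *)
have : (2 * #|F|)%N = (n * 3)%N by rewrite (card_pairing pF) card_prod !card_ord.
move/(congr1 (fun m => m%:R : R)); rewrite !natrM.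
have -> : #|[pred x | x \in F]| = #|F| by apply: eq_card.
have -> : #|[pred x | x \in porbits (cusp_perm O pF)]| = #|porbits (cusp_perm O pF)| by apply: eq_card.
lra.
Qed.

End Surface.

(** * Short cusps of a random configuration *)

Section Conjugation.
Context {T : finType}.
Implicit Types (F : {set {set T}}) (g : {perm T}).

Definition relabel g F : {set {set T}} := [set g @: e | e : {set T} in F]%SET.

Lemma relabel_pairing g F : pairing F -> pairing (relabel g F).
Proof.
case/andP=> /and3P[/eqP cF tF F0] /forall_inP F2.
have r2 e : e \in relabel g F -> #|e| == 2%N.
  by case/imsetP => e' e'F ->; rewrite card_imset ?F2 //; exact: perm_inj.
apply/andP; split; last exact/forall_inP.
apply/and3P; split.
- rewrite finset.eqEsubset finset.subsetT; apply/fintype.subsetP => y _.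
  have : (g^-1)%g y \in finset.cover F by rewrite cF inE.
  case/bigcupP => e eF ye; apply/bigcupP; exists (g @: e); first exact: imset_f.
  by rewrite -[y](permKV g) imset_f.
- apply/finset.trivIsetP => _ _ /imsetP[a aF ->] /imsetP[b bF ->] ab.
  rewrite imset_disjoint; last exact: perm_inj.
  by apply: (finset.trivIsetP tF) => //; apply: contra ab => /eqP ->.
- by apply/negP => /r2; rewrite cards0.
Qed.

Lemma relabel_partner g F h : pairing F -> partner (relabel g F) h = g (partner F ((g^-1)%g h)).
Proof.
move=> pF; apply/esym/eqP; rewrite -(partnerP _ _ (relabel_pairing g pF)).
have -> : [set h; g (partner F ((g^-1)%g h))]%SET = g @: [set (g^-1)%g h; partner F ((g^-1)%g h)]%SET.
  by rewrite imsetU1 imset_set1 permKV.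
by apply: imset_f; exact: partnerE.
Qed.

Lemma relabel_tpermK (b c : T) : involutive (relabel (tperm b c)).
Proof.
move=> F; rewrite /relabel -imset_comp -[RHS]imset_id; apply: eq_imset => e /=.
by rewrite -imset_comp -[RHS]imset_id; apply: eq_imset => x /=; rewrite tpermK.
Qed.

End Conjugation.

Lemma porbits_partition (T : finType) (s : {perm T}) :
  finset.partition (porbits s) [set: T]%SET.
Proof.
apply/and3P; split.
- rewrite finset.eqEsubset finset.subsetT; apply/fintype.subsetP => x _.
  by apply/bigcupP; exists (porbit s x); [exact: imset_f|exact: porbit_id].
- apply/finset.trivIsetP => _ _ /imsetP[x _ ->] /imsetP[y _ ->]; apply: contraR.
  case/pred0Pn => z /= /andP[]; rewrite -!eq_porbit_mem => /eqP <- /eqP <-.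
  by [].
- by apply/negP => /imsetP[x _ /setP/(_ x)]; rewrite porbit_id inE.
Qed.

(** * Walks around a cusp and the switching argument *)

Section ShortCusps.
Variables (n : nat) (O : orientation n).
Local Notation T := (half_edge n).
Local Notation C := (configurations n).
Implicit Types (F : {set {set T}}) (h : T).

(** The orbit of [cusp_perm], written without a proof that F is a pairing so that it makes sense for
    every F in a counting argument. *)
Definition walk F (h : T) (i : nat) : T := iter i (fun h => turn_fun O (partner F h)) h.

Definition visited F h t : seq 'I_n := [seq (walk F h i).1 | i <- iota 0 t.+1].

(** The first return to a vertex occurs when the edge after step t is crossed; turning does not
    change the vertex, so that of the partner is the next one visited. *)
Definition revisits F h t : bool :=
  uniq (visited F h t) && ((partner F (walk F h t)).1 \in visited F h t).

Lemma visitedS F h t : visited F h t.+1 = rcons (visited F h t) (partner F (walk F h t)).1.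
Proof. by rewrite /visited -[t.+2]addn1 iotaD map_cat /= cats1. Qed.

Lemma walk_cusp F (pF : pairing F) h i : walk F h i = ((cusp_perm O pF) ^+ i)%g h.
Proof.
rewrite permX /walk; elim: i => //= i ->.
by rewrite cusp_permE.
Qed.

(** If the first m + 1 vertices were distinct, so would be m + 1 half-edges of the orbit. *)
Lemma short_revisits F (pF : pairing F) h m :
  (#|porbit (cusp_perm O pF) h| <= m)%N -> exists2 t, (t < m)%N & revisits F h t.
Proof.
move=> cm.
suff : ~~ uniq (visited F h m).
  elim: m {cm} => // m IH; have [um|/IH[t tm rt] _] := boolP (uniq (visited F h m)).
    rewrite visitedS rcons_uniq um andbT negbK => vm.
    by exists m => //; rewrite /revisits um vm.
  by exists t => //; exact: ltnW.
apply: contraTN cm => um; rewrite -ltnNge.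
have uw : uniq [seq walk F h i | i <- iota 0 m.+1].
  by apply: (@map_uniq _ _ fst); rewrite -map_comp.
have <- : size [seq walk F h i | i <- iota 0 m.+1] = m.+1 by rewrite size_map size_iota.
rewrite -(card_uniqP uw); apply: subset_leq_card; apply/fintype.subsetP => x /mapP[i _ ->].
by rewrite (walk_cusp pF); exact: mem_porbit.
Qed.

Lemma turn_fun_neq h : turn_fun O h != h.
Proof.
case: h => v i; apply/eqP => -[] /(canRL (permKV _)) /esym/eqP; apply/negP.
by apply: order3_neq; apply/eqP; exact: (valP (O v)).
Qed.

Lemma uniq_visited_inj F h t i j : uniq (visited F h t) -> (i <= t)%N -> (j <= t)%N ->
  (walk F h i).1 = (walk F h j).1 -> i = j.
Proof.
move=> ut it jt E; have := nth_uniq (walk F h 0).1 _ _ ut.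
rewrite size_map size_iota => /(_ i j it jt).
rewrite !(nth_map 0%N) ?size_iota // !nth_iota // !add0n E eqxx.
by move/esym/eqP.
Qed.

(** The first t steps consult only the edges at [walk F h i] for i < t. Exchanging b and c alters
    none of them, so the walk survives while its last point gets the partner c. *)
Lemma walk_switch F h t c : pairing F -> uniq (visited F h t) ->
  let b := partner F (walk F h t) in let F' := relabel (tperm b c) F in
  (forall i, (i <= t)%N -> c != walk F h i) ->
  (forall i, (i < t)%N -> c != partner F (walk F h i)) ->
  (forall i, (i <= t)%N -> walk F' h i = walk F h i) /\ partner F' (walk F h t) = c.
Proof.
move=> pF ut b F' cw cp.
(* If b were an earlier point of the walk, the next step would land at the vertex of [walk F h t],
   hence would be step t itself, and a turn would fix a half-edge. *)
have bw i : (i <= t)%N -> b != walk F h i.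
  move=> it; apply/eqP => bE.
  have [ilt|tlei] := ltnP i t; last first.
    have it' : i = t by apply/eqP; rewrite eqn_leq it tlei.
    by have := partner_neq (walk F h t) pF; rewrite -/b bE it' eqxx.
  have wS : walk F h i.+1 = turn_fun O (walk F h t).
    by rewrite /walk iterS -/(walk F h i) -bE /b partnerK.
  have e : i.+1 = t by apply: (uniq_visited_inj ut) => //; rewrite wS.
  by have := turn_fun_neq (walk F h t); rewrite -wS e eqxx.
have bp i : (i < t)%N -> b != partner F (walk F h i).
  move=> it; apply/eqP => /(can_inj (partnerK pF)) E.
  have := uniq_visited_inj ut (leqnn t) (ltnW it) (congr1 fst E).
  by move=> ti; rewrite ti ltnn in it.
split.
  elim=> // i IH it; rewrite /walk !iterS -!/(walk _ _ i) IH ?(ltnW it) //.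
  rewrite relabel_partner // tpermV (tpermD (z := walk F h i)) ?bw ?cw ?(ltnW it) //.
  by rewrite tpermD // ?bp ?cp.
by rewrite relabel_partner // tpermV (tpermD (z := walk F h t)) ?bw ?cw // tpermL.
Qed.

(* Double counting: if b is the partner of the last point of the walk, then the
   switch of (F, c) to (relabel (tperm b c) F, b) can be undone, since c is the
   new partner of that point. *)
Lemma card_revisits h t :
  (#|[set F in C | revisits F h t]%SET| * (#|T| - t.*2.+1) <= #|C| * (3 * t.+1))%N.
Proof.
(* The excluded choices of c: t + 1 points of the walk and t partners, at most 2t + 1 half-edges. *)
pose Ex F := [seq walk F h i | i <- iota 0 t.+1] ++ [seq partner F (walk F h i) | i <- iota 0 t].
pose A := [set p : {set {set T}} * T | [&& p.1 \in C, revisits p.1 h t & p.2 \notin Ex p.1]]%SET.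
pose B := [set p : {set {set T}} * T | (p.1 \in C) && (p.2.1 \in visited p.1 h t)]%SET.
pose g (p : {set {set T}} * T) :=
  let c := partner p.1 (walk p.1 h t) in (relabel (tperm p.2 c) p.1, c).
have AB : (#|A| <= #|B|)%N.
  apply: leq_trans (leq_imset_card g B); apply: subset_leq_card.
  apply/fintype.subsetP => -[F c]; rewrite inE => /and3P[/= FC /andP[ut rt] cE].
  rewrite configurationP in FC.
  have cw i : (i <= t)%N -> c != walk F h i.
    move=> it; apply: contra cE => /eqP ->.
    have iI : i \in iota 0 t.+1 by rewrite mem_iota.
    by rewrite mem_cat; apply/orP; left; apply/mapP; exists i.
  have cp i : (i < t)%N -> c != partner F (walk F h i).
    move=> it; apply: contra cE => /eqP ->.
    have iI : i \in iota 0 t by rewrite mem_iota.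
    by rewrite mem_cat; apply/orP; right; apply/mapP; exists i.
  have [wE pE] := walk_switch FC ut cw cp.
  set b := partner F (walk F h t) in wE pE rt *; set F' := relabel (tperm b c) F in wE pE *.
  apply/imsetP; exists (F', b); last first.
    by rewrite /g /= wE // pE relabel_tpermK.
  rewrite inE /= configurationP relabel_pairing //=.
  rewrite (_ : visited F' h t = visited F h t) //; apply/eq_in_map => i.
  by rewrite mem_iota add0n ltnS => it; rewrite wE.
(* After the switch b is any half-edge at one of at most t + 1 visited vertices, each of which has
   three. *)
have cardB : (#|B| <= #|C| * (3 * t.+1))%N.
  rewrite -sum1_card (eq_bigl (fun p => (p.1 \in C) && (p.2.1 \in visited p.1 h t))); last first.
    by move=> p; rewrite inE.
  rewrite -(pair_big_dep (mem C) (fun F x => x.1 \in visited F h t) (fun _ _ => 1%N)) /=.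
  rewrite -sum_nat_const; apply: leq_sum => F _; rewrite sum1_card.
  have -> : #|[pred x : T | x.1 \in visited F h t]| =
      #|finset.setX [set v in visited F h t]%SET [set: 'I_3]%SET|.
    by apply: eq_card => x; rewrite !inE andbT.
  rewrite cardsX cardsT card_ord mulnC leq_mul2l /= cardsE.
  by apply: leq_trans (card_size _) _; rewrite size_map size_iota.
apply: leq_trans (leq_trans AB cardB).
rewrite -[X in (_ <= X)%N]sum1_card (eq_bigl (fun p => ((p.1 \in C) && revisits p.1 h t) && (p.2 \notin Ex p.1))); last first.
  by move=> p; rewrite inE andbA.
rewrite -(pair_big_dep (fun F => (F \in C) && revisits F h t) (fun F x => x \notin Ex F) (fun _ _ => 1%N)) /=.
rewrite -sum_nat_const [X in (X <= _)%N](eq_bigl (fun F => (F \in C) && revisits F h t)); last first.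
  by move=> F; rewrite inE.
apply: leq_sum => F _; rewrite sum1_card.
have := cardC (mem (Ex F)); rewrite (_ : #|[predC mem (Ex F)]| = #|[pred x | x \notin Ex F]|); last by apply: eq_card.
have : (#|mem (Ex F)| <= t.*2.+1)%N.
  by apply: leq_trans (card_size _) _; rewrite size_cat !size_map !size_iota -addnn.
by move=> h1 <-; rewrite leq_subLR leq_add2r.
Qed.

(* Half-edges in cusps of length at most 6 revisit a triangle before time 6; the
   other cusps number at most 3n / 7, which is less than n / 2. *)
Definition short F : {set T} := [set h | [exists t : 'I_6, revisits F h t]]%SET.

(** Each cusp pays 7, either by its own length or by a short half-edge in it. *)
Lemma cusps_le F (pF : pairing F) :
  (7 * #|porbits (cusp_perm O pF)| <= #|T| + 7 * #|short F|)%N.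
Proof.
have pP : finset.partition (porbits (cusp_perm O pF)) [set: T]%SET.
  exact: porbits_partition.
have -> : #|T| = (\sum_(c in porbits (cusp_perm O pF)) #|c|)%N.
  by rewrite -cardsT (card_partition pP).
have -> : #|short F| = (\sum_(c in porbits (cusp_perm O pF)) #|c :&: short F|)%N.
  rewrite -sum1_card (eq_bigl (fun h => (h \in [set: T]%SET) && (h \in short F))); last first.
    by move=> h; rewrite finset.in_setT.
  rewrite (set_partition_big_cond _ pP) /=; apply: eq_bigr => c _.
  by rewrite -sum1_card; apply: eq_bigl => h; rewrite finset.in_setI.
rewrite big_distrr /= -big_split /= mulnC -sum_nat_const.
apply: leq_sum => c /imsetP[h _ cE].
have [c6|] := leqP #|c| 6; last by move=> c7; apply: leq_trans c7 (leq_addr _ _).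
have : (0 < #|c :&: short F|)%N.
  apply/card_gt0P; exists h; rewrite !inE cE porbit_id /=.
  rewrite cE in c6; have [t t6 rt] := short_revisits c6.
  by apply/existsP; exists (Ordinal t6).
by move=> c0; apply: leq_trans (leq_addl _ _); rewrite leq_pmulr.
Qed.

(** For t < 6 a half-edge revisits at time t in at most a fraction 18 / (|T| - 11) of the
    configurations, with 18 = 3 * 6 and 11 = 2 * 5 + 1. Summing over |T| half-edges and six times
    gives 108 |T| / (|T| - 11), at most 216 once |T| >= 22. *)
Lemma sum_short : (22 <= #|T|)%N -> (\sum_(F in C) #|short F| <= 216 * #|C|)%N.
Proof.
move=> T22.
pose S := (\sum_(h : T) \sum_(t < 6) #|[set F in C | revisits F h t]%SET|)%N.
have le1 : (\sum_(F in C) #|short F| <= S)%N.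
  rewrite /S exchange_big /=.
  have E (t : 'I_6) : (\sum_(h : T) #|[set F in C | revisits F h t]%SET| =
      \sum_(F in C) \sum_(h : T) revisits F h t)%N.
    rewrite exchange_big; apply: eq_bigr => h _ /=.
    rewrite -sum1_card big_mkcond [RHS]big_mkcond /=; apply: eq_bigr => F _.
    by rewrite inE; case: (F \in C).
  rewrite (eq_bigr _ (fun t _ => E t)) exchange_big; apply: leq_sum => F _ /=.
  rewrite exchange_big -sum1_card big_mkcond /=; apply: leq_sum => h _ /=.
  rewrite inE; case: existsP => // -[t rt].
  by rewrite (bigD1 t) //= rt.
have le2 : (S * (#|T| - 11) <= #|T| * (6 * (#|C| * 18)))%N.
  rewrite /S big_distrl /= -sum_nat_const; apply: leq_sum => h _.
  apply: (@leq_trans (\sum_(t < 6) #|C| * 18)%N); last by rewrite sum_nat_const card_ord.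
  rewrite big_distrl; apply: leq_sum => t _.
  have := card_revisits h t; have := ltn_ord t; move: (val t) => {}t t6 le.
  have l1 : (#|T| - 11 <= #|T| - t.*2.+1)%N by lia.
  apply: leq_trans (leq_mul (leqnn _) l1) (leq_trans le _).
  by rewrite leq_mul2l; apply/orP; right; lia.
nia.
Qed.

End ShortCusps.

(** * Counting orientations and existence of configurations *)

Lemma order3_cases (s : {perm 'I_3}) : #[s]%g = 3%N ->
  s = perm (@addrI _ (1 : 'I_3)) \/ s = perm (@addrI _ (1 + 1 : 'I_3)).
Proof.
move=> s3; have n0 := order3_neq ord0 s3; have n1 := order3_neq 1 s3; have n2 := order3_neq (1 + 1) s3.
have i01 : s ord0 != s 1 by rewrite (inj_eq perm_inj).
have i02 : s ord0 != s (1 + 1) by rewrite (inj_eq perm_inj).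
have i12 : s 1 != s (1 + 1) by rewrite (inj_eq perm_inj).
have brute (a b c : 'I_3) : a != ord0 -> b != 1 -> c != 1 + 1 -> a != b -> a != c -> b != c ->
    [/\ a = 1, b = 1 + 1 & c = ord0] \/ [/\ a = 1 + 1, b = ord0 & c = 1].
  by elim/ord3P: a; elim/ord3P: b; elim/ord3P: c => //= *;
    first [by left; split; apply/val_inj|by right; split; apply/val_inj].
have [[a b c]|[a b c]] := brute _ _ _ n0 n1 n2 i01 i02 i12; [left|right];
  by apply/permP; elim/ord3P; rewrite permE ?a ?b ?c; apply/val_inj.
Qed.

Lemma order3_shift (a : 'I_3) : a != 0 -> #[perm (@addrI _ a)]%g = 3%N.
Proof.
move=> a0; apply: nt_prime_order => //.
  apply/permP => i; rewrite permX perm1 /= !permE.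
  by move: a0; elim/ord3P: a => // _; elim/ord3P: i; apply/val_inj.
by apply: contra a0 => /eqP/permP/(_ 0); rewrite permE perm1 addr0 => /eqP.
Qed.

Lemma card_cyclic_ordering : #|cyclic_ordering| = 2%N.
Proof.
rewrite card_sig.
rewrite (eq_card (B := [set perm (@addrI _ (1 : 'I_3)); perm (@addrI _ (1 + 1 : 'I_3))]%SET)).
  rewrite cards2; case: eqP => // /permP/(_ 0); rewrite !permE.
  by move=> /(congr1 val).
move=> s; rewrite !inE; apply/idP/idP => [/eqP/order3_cases[]->|]; rewrite ?eqxx ?orbT //.
by case/orP=> /eqP ->; rewrite order3_shift.
Qed.

(** Hence the weights 2^-n add up to 1, and a bound valid for each orientation passes to the
    average. *)
Lemma card_orientation n : #|orientation n| = (2 ^ n)%N.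
Proof. by rewrite card_ffun card_cyclic_ordering card_ord. Qed.

Lemma pairing_involution (T : finType) (f : T -> T) : involutive f -> (forall x, f x != x) ->
  pairing [set [set x; f x]%SET | x : T]%SET.
Proof.
move=> fK fn; apply/andP; split; last first.
  by apply/forall_inP => _ /imsetP[x _ ->]; rewrite cards2 (eq_sym x) fn.
apply/and3P; split.
- rewrite finset.eqEsubset finset.subsetT; apply/fintype.subsetP => x _.
  by apply/bigcupP; exists [set x; f x]%SET; [exact: imset_f|exact: finset.set21].
- apply/finset.trivIsetP => _ _ /imsetP[x _ ->] /imsetP[y _ ->]; apply: contraR.
  case/pred0Pn => z /= /andP[]; rewrite !inE => /orP[]/eqP zx /orP[]/eqP zy.
  + by rewrite -zx -zy.
  + by rewrite -zx zy fK finset.setUC.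
  + by rewrite -zy zx fK finset.setUC.
  + by rewrite -[x]fK -[y]fK -zx -zy.
- apply/negP => /imsetP[x _ /setP/(_ x)]; by rewrite !inE eqxx.
Qed.

(** The vertices 2j and 2j + 1 are joined by three parallel edges; evenness of n keeps the second
    one in range. Nonemptiness makes the division by [#|configurations n|] meaningful. *)
Lemma configurations_neq0 n : ~~ odd n -> (0 < #|configurations n|)%N.
Proof.
move=> en.
have lt (v : 'I_n) : ((if odd v then v.-1 else v.+1) < n)%N.
  have := ltn_ord v; case: ifP => ov; first by lia.
  rewrite leq_eqVlt => /orP[/eqP vn|//].
  by exfalso; move: en; rewrite -vn /= ov.
pose f (h : half_edge n) : half_edge n := (Ordinal (lt h.1), h.2).
have fK : involutive f.
  move=> [v i]; congr (_, _); apply/val_inj => /=.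
  have [ov|/negbTE ov] := boolP (odd v); last by rewrite /= ov.
  by case: (nat_of_ord v) ov => // m /= /negbTE ->.
have fn x : f x != x.
  case: x => v i; apply/eqP => /(congr1 (fun x => nat_of_ord x.1)) /= /eqP.
  case: ifP => ov; last by rewrite gtn_eqF.
  by case: (nat_of_ord v) ov => // m _ /=; rewrite ltn_eqF.
apply/card_gt0P; exists [set [set x; f x]%SET | x : half_edge n]%SET.
by rewrite configurationP; exact: pairing_involution.
Qed.

(** * The expected genus *)

Section Expectation.
Variables (R : realType) (n : nat).
Local Notation C := (configurations n).

(** With S short half-edges there are at most 3n/7 + S cusps, and half of n/2 - 3n/7 - S is n/28 -
    S/2. *)
Lemma genus_ge_short (F : {set {set half_edge n}}) (O : orientation n) : F \in C ->
  n%:R / 28 - #|short O F|%:R / 2 <= total_genus R (compact_surface R F O).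
Proof.
rewrite configurationP => pF; apply: le_trans (compact_surface_genus_ge O pF).
have := cusps_le O pF; rewrite card_prod !card_ord -(ler_nat R) natrD !natrM.
lra.
Qed.

Lemma expected_genusE : expected_genus R n = \sum_(O : orientation n)
  2^-1 ^+ n * (#|C|%:R^-1 * \sum_(F in C) total_genus R (compact_surface R F O)).
Proof.
rewrite /expected_genus exchange_big; apply: eq_bigr => O _ /=.
by rewrite !mulr_sumr; apply: eq_bigr => F _; rewrite mulrCA mulrA.
Qed.

Lemma orientation_average (x : R) : \sum_(O : orientation n) 2^-1 ^+ n * x = x.
Proof.
rewrite sumr_const card_orientation -mulrnAl -[_ *+ _]mulr_natl natrX exprVn.
by rewrite mulfV ?mul1r // expf_neq0 // pnatr_eq0.
Qed.

Hypothesis n_even : ~~ odd n.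

Lemma expected_genus_le : expected_genus R n <= 32 * n%:R.
Proof.
have C0 : 0 < #|C|%:R :> R by rewrite ltr0n configurations_neq0.
rewrite expected_genusE -[leRHS]orientation_average; apply: ler_sum => O _.
rewrite ler_wpM2l ?exprn_ge0 ?invr_ge0 // ler_pdivrMl //.
have -> : #|C|%:R * (32 * n%:R) = \sum_(F in C) 32 * n%:R :> R.
  by rewrite sumr_const -[RHS]mulr_natl.
apply: ler_sum => F; by rewrite configurationP => pF; exact: compact_surface_genus_le.
Qed.

(** The loss 108 is half of the bound 216 on the mean number of short half-edges; n >= 8 provides
    the 22 half-edges that this bound requires. *)
Lemma expected_genus_ge : (8 <= n)%N -> n%:R / 28 - 108 <= expected_genus R n.
Proof.
move=> n8; have C0 : 0 < #|C|%:R :> R by rewrite ltr0n configurations_neq0.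
rewrite expected_genusE -[leLHS]orientation_average; apply: ler_sum => O _.
rewrite ler_wpM2l ?exprn_ge0 ?invr_ge0 // ler_pdivlMl //.
have T22 : (22 <= #|half_edge n|)%N by rewrite card_prod !card_ord; lia.
apply: (@le_trans _ _ (\sum_(F in C) (n%:R / 28 - #|short O F|%:R / 2))); last first.
  by apply: ler_sum => F FC; exact: genus_ge_short.
rewrite sumrB sumr_const -mulr_suml -natr_sum -mulr_natl.
have := sum_short O T22; rewrite -(ler_nat R) natrM.
lra.
Qed.

End Expectation.

Theorem theorem1p1 (R : realType) :
  exists c1 c2 : R,
    [/\ 0 < c1, c1 <= c2 &
      exists N : nat, forall n : nat, (N <= n)%N -> ~~ odd n ->
        c1 * n%:R <= expected_genus R n <= c2 * n%:R].
Proof.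
(* Half of the slope 1/28 is given up to absorb the constant: n/56 >= 108 holds from n = 108 * 56 =
   6048 on. *)
exists 56^-1, 32; split; [by lra|by lra|exists 6048 => n nN n_even].
rewrite expected_genus_le // andbT.
apply: le_trans (expected_genus_ge R n_even _); last exact: leq_trans nN.
have : (6048%:R <= n%:R :> R) by rewrite ler_nat.
lra.
Qed.
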